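(* (DMT outer bound.) Consider the two-user fading interference channel of the context with interference level $\alpha$ and multiplexing rates $\mathbf r=[r_1\ r_2]^T$, $0\le r_i\le 1$. For any communication scheme $\chi$ over this channel, with error probability $P(E^\chi)$, $$P(E^\chi)\ \dot\ge\ \mathsf{SNR}^{-\max_{\mathbf s}d_1^{ETW}(\mathbf r,\mathbf s)},\qquad\text{i.e.,}\qquad d^\chi(\mathbf r)\le\max_{\mathbf s}d_1^{ETW}(\mathbf r,\mathbf s),$$ where the maximum is over $\mathbf s=[s_1\ s_2]^T$ with $r_i=s_i+t_i$, $0\le s_i,t_i\le r_i$ $(i=1,2)$, and $d_1^{ETW}(\mathbf r,\mathbf s)=\min_{i=1,2,3,4}d_{1i}^{ETW}(\mathbf r,\mathbf s)$ with $$d_{1i}^{ETW}(\mathbf r,\mathbf s)=(1-r_i)^+\quad(i=1,2),$$ $$d_{13}^{ETW}(\mathbf r,\mathbf s)=(1-r_1-r_2+s_2)^++(\alpha-r_1-r_2+s_2)^+,$$ $$d_{14}^{ETW}(\mathbf r,\mathbf s)=\begin{cases}(1-\alpha-s_2)^+,& s_2>0\text{ and }\alpha<1\\ 1,& s_2=0\\ 0,& s_2>0\text{ and }\alpha\ge1.\end{cases}$$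
   Context: **Exponential (in)equality.** For positive functions $f,g$ of $\mathsf{SNR}$, $f\doteq g$ means $\lim_{\mathsf{SNR}\to\infty}\frac{\log f}{\log\mathsf{SNR}}=\lim_{\mathsf{SNR}\to\infty}\frac{\log g}{\log\mathsf{SNR}}$; $\dot\ge,\dot\le$ are defined analogously. Logarithms are to base 2 and $(a)^+=\max(a,0)$. **System model.** Two transmitters $\mathcal T_1,\mathcal T_2$ and two receivers $\mathcal R_1,\mathcal R_2$; over a block of length $N$, $$\mathbf y_1=\sqrt{\mathsf{SNR}}\,h_{11}\mathbf x_1+\sqrt{\mathsf{SNR}^\alpha}\,h_{21}\mathbf x_2+\mathbf z_1,\qquad \mathbf y_2=\sqrt{\mathsf{SNR}^\alpha}\,h_{12}\mathbf x_1+\sqrt{\mathsf{SNR}}\,h_{22}\mathbf x_2+\mathbf z_2,$$ with $\alpha\in[0,\infty)$, $\mathbf x_i\in\mathbb C^N$, $\|\mathbf x_i\|^2\le N$, noise $\mathbf z_i\sim\mathcal{CN}(\mathbf 0,\mathbf I_N)$, and scalar fading coefficients $h_{ij}\sim\mathcal{CN}(0,1)$, independent of each other and of the noise, constant over the block. Receiver $\mathcal R_i$ knows $\mathbf h_i=[h_{1i}\ h_{2i}]^T$, $\mathsf{SNR}$ and $\alpha$; transmitters know only the channel statistics, $\mathsf{SNR}$ and $\alpha$. $\mathcal T_i$ has rate $R_i=r_i\log\mathsf{SNR}$, $0\le r_i\le1$, i.e. it uses a sequence of codebooks (one for each $\mathsf{SNR}$) of size $2^{NR_i}$; messages are uniform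 and independent. **Error probability and DMT.** For a communication scheme $\chi$ (codebooks and decoders), $P(E_i^\chi)$ is the probability, averaged over the channel, that $\mathcal R_i$ decodes the message of $\mathcal T_i$ incorrectly; $P(E^\chi)=\max\{P(E_1^\chi),P(E_2^\chi)\}$ and $d^\chi(\mathbf r)=-\lim_{\mathsf{SNR}\to\infty}\frac{\log P(E^\chi)}{\log\mathsf{SNR}}$. *)

(* Defs.v *)
From HB Require Import structures.
From mathcomp Require Import all_boot all_order all_algebra.
From mathcomp Require Import all_classical all_reals all_analysis.
From mathcomp Require Export complex.

Set Implicit Arguments.
Unset Strict Implicit.
Unset Printing Implicit Defensive.

Import Order.TTheory GRing.Theory Num.Theory.
Import numFieldNormedType.Exports.

Local Open Scope classical_set_scope.
Local Open Scope ring_scope.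
Local Open Scope complex_scope.

(* Real coordinates of a family of complex-valued functions: (i, false) is the
   real part and (i, true) the imaginary part of the i-th member. *)
Definition reim (R : realType) (X I : Type) (f : I -> X -> R[i])
    (p : I * bool) (x : X) : R :=
  if p.2 then complex.Im (f p.1 x) else complex.Re (f p.1 x).

(* The sigma-algebra on X generated by a family of complex-valued functions
   (R[i] carries no measurable structure in the library, so Borel sets are taken
   coordinatewise). *)
Definition sigma_gen (R : realType) (X I : Type) (f : I -> X -> R[i]) :
    set (set X) :=
  <<s [set A | exists (p : I * bool) (B : set R),
         measurable B /\ A = reim f p @^-1` B] >>.

Definition mutually_independent (R : realType) (d : measure_display)
    (T : measurableType d) (P : probability T R) (I : finType)
    (F : I -> set (set T)) : Prop :=
  forall (J : {set I}) (A : I -> set T),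
    (forall i, i \in J -> F i (A i)) ->
    P (\bigcap_(i in [set i | i \in J]) A i) = (\prod_(i in J) P (A i))%E.

(* The complex random vector (Z i)_(i : I) has law CN(0, Id): all its real and
   imaginary parts are independent, of law N(0, 1/2). *)
Definition std_CN (R : realType) (d : measure_display) (T : measurableType d)
    (P : probability T R) (I : finType) (Z : I -> T -> R[i]) : Prop :=
  [/\ forall p, measurable_fun [set: T] (reim Z p),
      forall p (B : set R), measurable B ->
        P (reim Z p @^-1` B) = normal_prob 0 (Num.sqrt 2^-1) B
    & mutually_independent P
        (fun p : I * bool => preimage_set_system [set: T] (reim Z p) measurable)].

(* hji is the fading coefficient from transmitter j to receiver i, and zi is the
   noise at receiver i. *)
Record channel (R : realType) (T : Type) (N : nat) := Channel {
  h11 : T -> R[i];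
  h12 : T -> R[i];
  h21 : T -> R[i];
  h22 : T -> R[i];
  z1 : T -> 'cV[R[i]]_N;
  z2 : T -> 'cV[R[i]]_N }.

(* The four fading coefficients and the pair (z1, z2) are independent; the
   dependence between z1 and z2 is left arbitrary. *)
Definition rayleigh (R : realType) (d : measure_display) (T : measurableType d)
    (P : probability T R) (N : nat) (ch : channel R T N) : Prop :=
  [/\ std_CN P (fun _ : unit => h11 ch) /\ std_CN P (fun _ : unit => h12 ch),
      std_CN P (fun _ : unit => h21 ch) /\ std_CN P (fun _ : unit => h22 ch),
      std_CN P (fun (k : 'I_N) w => z1 ch w k 0),
      std_CN P (fun (k : 'I_N) w => z2 ch w k 0)
    & mutually_independent P (fun b : 'I_5 => nth set0
        [:: sigma_gen (fun _ : unit => h11 ch);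
            sigma_gen (fun _ : unit => h12 ch);
            sigma_gen (fun _ : unit => h21 ch);
            sigma_gen (fun _ : unit => h22 ch);
            sigma_gen (fun (k : 'I_N + 'I_N) w =>
              match k with inl k1 => z1 ch w k1 0 | inr k2 => z2 ch w k2 0 end)]
        b)].

(* A receiver observes its received block and its two fading coefficients. *)
Definition observation (R : realType) (N : nat) : Type :=
  ('cV[R[i]]_N * 'cV[R[i]]_2)%type.

Definition obs_coord (R : realType) (N : nat) (k : 'I_N + 'I_2)
    (o : observation R N) : R[i] :=
  match k with inl k1 => o.1 k1 0 | inr k2 => o.2 k2 0 end.

(* Codebooks and decoders used at one value of SNR. *)
Record block_code (R : realType) (N : nat) := BlockCode {
  size1 : nat;
  size2 : nat;
  enc1 : 'I_size1 -> 'cV[R[i]]_N;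
  enc2 : 'I_size2 -> 'cV[R[i]]_N;
  dec1 : observation R N -> 'I_size1;
  dec2 : observation R N -> 'I_size2 }.

Arguments enc1 {R N} _ _.
Arguments enc2 {R N} _ _.
Arguments dec1 {R N} _ _.
Arguments dec2 {R N} _ _.

Definition log2 (R : realType) (x : R) : R := ln x / ln 2.

Definition power_ok (R : realType) (N : nat) (x : 'cV[R[i]]_N) : Prop :=
  \sum_(k < N) `|x k 0| ^+ 2 <= N%:R.

(* The codebook size is 2^(N rate), rounded up or down when not an integer. *)
Definition size_ok (R : realType) (N : nat) (rate : R) (M : nat) : Prop :=
  `|M%:R - 2 `^ (N%:R * rate)| < 1.

(* Borel measurability of a decoder. *)
Definition decoder_ok (R : realType) (N M : nat)
    (dec : observation R N -> 'I_M) : Prop :=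
  forall m : 'I_M, sigma_gen (@obs_coord R N) [set o | dec o = m].

(* A communication scheme is a family of codes, one for each SNR. *)
Definition is_scheme (R : realType) (N : nat) (r1 r2 : R)
    (chi : R -> block_code R N) : Prop :=
  forall snr : R, 1 < snr ->
    [/\ size_ok N (r1 * log2 snr) (size1 (chi snr)) /\
        size_ok N (r2 * log2 snr) (size2 (chi snr)),
        forall m, power_ok (enc1 (chi snr) m),
        forall m, power_ok (enc2 (chi snr) m),
        decoder_ok (dec1 (chi snr))
      & decoder_ok (dec2 (chi snr))].

(* Received block: hd, xd are the direct link and signal, hc, xc the cross ones. *)
Definition received (R : realType) (N : nat) (snr alpha : R)
    (hd hc : R[i]) (xd xc z : 'cV[R[i]]_N) : 'cV[R[i]]_N :=
  ((Num.sqrt snr)%:C * hd) *: xd + ((Num.sqrt (snr `^ alpha))%:C * hc) *: xc + z.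

Definition hvec (R : realType) (a b : R[i]) : 'cV[R[i]]_2 :=
  \col_(j < 2) (if j == 0 then a else b).

Definition obs1 (R : realType) (T : Type) (N : nat) (ch : channel R T N)
    (snr alpha : R) (x1 x2 : 'cV[R[i]]_N) (w : T) : observation R N :=
  (received snr alpha (h11 ch w) (h21 ch w) x1 x2 (z1 ch w),
   hvec (h11 ch w) (h21 ch w)).

Definition obs2 (R : realType) (T : Type) (N : nat) (ch : channel R T N)
    (snr alpha : R) (x1 x2 : 'cV[R[i]]_N) (w : T) : observation R N :=
  (received snr alpha (h22 ch w) (h12 ch w) x2 x1 (z2 ch w),
   hvec (h12 ch w) (h22 ch w)).

(* Error probabilities, averaged over uniform independent messages, the channel
   and the noise. *)
Definition perr1 (R : realType) (d : measure_display) (T : measurableType d)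
    (P : probability T R) (N : nat) (ch : channel R T N) (snr alpha : R)
    (c : block_code R N) : R :=
  (size1 c * size2 c)%:R^-1 *
  \sum_(m1 < size1 c) \sum_(m2 < size2 c)
    fine (P [set w |
      dec1 c (obs1 ch snr alpha (enc1 c m1) (enc2 c m2) w) <> m1]).

Definition perr2 (R : realType) (d : measure_display) (T : measurableType d)
    (P : probability T R) (N : nat) (ch : channel R T N) (snr alpha : R)
    (c : block_code R N) : R :=
  (size1 c * size2 c)%:R^-1 *
  \sum_(m1 < size1 c) \sum_(m2 < size2 c)
    fine (P [set w |
      dec2 c (obs2 ch snr alpha (enc1 c m1) (enc2 c m2) w) <> m2]).

Definition perr (R : realType) (d : measure_display) (T : measurableType d)
    (P : probability T R) (N : nat) (ch : channel R T N) (alpha : R)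
    (chi : R -> block_code R N) (snr : R) : R :=
  Num.max (perr1 P ch snr alpha (chi snr)) (perr2 P ch snr alpha (chi snr)).

Definition exponent (R : realType) (f : R -> R) (snr : R) : \bar R :=
  (log2 (f snr) / log2 snr)%:E.

(* Exponential inequality between (eventually) positive functions of SNR.  When
   both exponents converge this is lim (exponent g) <= lim (exponent f); lower and
   upper limits keep it meaningful for schemes whose exponent does not converge. *)
Definition dot_ge (R : realType) (f g : R -> R) : Prop :=
  (limf_esup (exponent g) (pinfty_nbhs R) <=
   limf_einf (exponent f) (pinfty_nbhs R))%E.

Definition has_diversity (R : realType) (p : R -> R) (d : \bar R) : Prop :=
  (fun snr => (- exponent p snr)%E) @ pinfty_nbhs R --> d.

Definition pos_part (R : realType) (a : R) : R := Num.max a 0.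

Definition d11 (R : realType) (r1 : R) : R := pos_part (1 - r1).
Definition d12 (R : realType) (r2 : R) : R := pos_part (1 - r2).
Definition d13 (R : realType) (alpha r1 r2 s2 : R) : R :=
  pos_part (1 - r1 - r2 + s2) + pos_part (alpha - r1 - r2 + s2).
Definition d14 (R : realType) (alpha s2 : R) : R :=
  if s2 == 0 then 1 else if alpha < 1 then pos_part (1 - alpha - s2) else 0.

(* s1 does not enter the formula; it is kept as in the definition of d_1(r, s). *)
Definition d1ETW (R : realType) (alpha r1 r2 s1 s2 : R) : R :=
  Num.min (Num.min (d11 r1) (d12 r2))
          (Num.min (d13 alpha r1 r2 s2) (d14 alpha s2)).

Definition rate_split (R : realType) (r s t : R) : Prop :=
  [/\ r = s + t, 0 <= s <= r & 0 <= t <= r].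

Definition d1ETW_values (R : realType) (alpha r1 r2 : R) : set R :=
  [set D | exists s1 s2 t1 t2 : R,
     [/\ rate_split r1 s1 t1, rate_split r2 s2 t2
       & D = d1ETW alpha r1 r2 s1 s2]].

Definition is_max (R : realType) (S : set R) (D : R) : Prop :=
  S D /\ ubound S D.

(* Main.v *)
Require Import Defs.
From mathcomp Require Import all_boot all_order all_algebra.
From mathcomp Require Import all_classical all_reals all_analysis.
From mathcomp Require Import measurable_realfun ring lra.

Import Order.TTheory GRing.Theory Num.Theory.
Import numFieldNormedType.Exports.

Set Implicit Arguments.
Unset Strict Implicit.
Unset Printing Implicit Defensive.

Local Open Scope classical_set_scope.
Local Open Scope ring_scope.

(** The converse is a finite-blocklength argument at a single large SNR.  Suppose
that both error probabilities are below SNR^(-e) with e > e' > D, and put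
u = 1 - e'.  A fading event of probability at least a constant times SNR^(-e')
then contains a realisation for which the conditional error probability is small,
so all the gains can be frozen.

The law of a shifted Gaussian noise vector x + z with all coordinates of x bounded
by sigma is dominated by C sigma^(2N) times the law of sigma z.  Hence disjoint
decoding regions are limited to about sigma^(2N) messages, which gives r_i <= u.
For the sum rate, let receiver 1 decode its message and keep the second messages
whose codewords are close to the rest of its received word; at receiver 2 these lie
in a small ball, so only few of them are decodable.  With |h11|^2 = SNR^(-b),
|h21|^2 = SNR^(-a), |h22|^2 = SNR^(-e') and a + b <= e' this gives
  r1 + r2 <= max(1 - b, alpha - a) + (u - alpha + a)^+.
If u <= alpha, suitable a and b show that s2 = 0 attains e'; if u > alpha, the case
a = 0, b = e' shows that s2 = min(r2, u - alpha) does. *)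

(** * The one-dimensional normal law *)

(** [N] stays fixed while SNR grows, so a volume count takes the place of entropy inequalities:
    factors depending only on [N] and the tightness radius are harmless against SNR^(N g) with g >
    0. The codebooks do not depend on the gains, so the two receivers may be frozen at two different
    sample points. Each of the two fading events, not their intersection, must then have probability
    of order at least SNR^(-e'); this is why a + b and the exponent of |h22|^2 may each go up to e'.
    The lower bound on |h21| serves the list: a received word known up to O(1) pins down the second
    codeword up to SNR^((a - alpha)/2) only if the cross gain is not too small. The exponent e' lies
    strictly between D and min(e, 1): the gap e - e' absorbs constants and e' < 1 keeps u positive.
    If D >= 1, both rates vanish, and a single message per user is never decoded wrongly, against
    the eventual positivity of the error probability. *)

Lemma measurable_affine (R : realType) (a b : R) :
  measurable_fun [set: measurableTypeR R]
    ((fun x => a * x + b) : measurableTypeR R -> measurableTypeR R).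
Proof. by apply: measurable_funD => //; apply: measurable_funM. Qed.

Definition pushforward_measure d1 d2 (T1 : measurableType d1)
    (T2 : measurableType d2) (R : realType) (m : {measure set T1 -> \bar R})
    (f : T1 -> T2) (mf : measurable_fun setT f) : {measure set T2 -> \bar R} :=
  measure_function_pushforward__canonical__measure_function_Measure m mf.

Definition affine_measure (R : realType) (a b : R) (a0 : 0 < a) :
    {measure set (measurableTypeR R) -> \bar R} :=
  mscale (NngNum (ltW a0))
    (pushforward_measure lebesgue_measure (measurable_affine a b)).

(** The right-hand side is a measure that gives each half-open interval its length, so uniqueness of
    Lebesgue measure applies. *)
Lemma lebesgue_measure_affine (R : realType) (a b : R) (A : set R) : 0 < a ->
  measurable A ->
  lebesgue_measure A = (a%:E * lebesgue_measure ((fun x => a * x + b)%R @^-1` A))%E.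
Proof.
move=> a0 mA.
rewrite (lebesgue_measure_unique (mu := affine_measure b a0)) //.
move=> _ [[x y] _ <-] /=; rewrite /mscale /= /pushforward /=.
have -> : (fun t : R => a * t + b) @^-1` `]x, y] =
    `](x - b) / a, (y - b) / a]%classic.
  apply/seteqP; split => z /=; rewrite !in_itv /= => /andP[h1 h2]; apply/andP; split.
  - by rewrite ltr_pdivrMr // mulrC ltrBlDr.
  - by rewrite ler_pdivlMr // mulrC lerBrDr.
  - by rewrite -ltrBlDr mulrC -ltr_pdivrMr.
  - by rewrite -lerBrDr mulrC -ler_pdivlMr.
rewrite !lebesgue_measure_itv /= !lte_fin ltr_pM2r ?invr_gt0 // ltrD2r.
case: ifP => _; last by rewrite mule0.
by rewrite -!EFinB -EFinM; congr EFin; field; rewrite gt_eqF.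
Qed.

Lemma ge0_integral_affine (R : realType) (a b : R) (f : R -> \bar R) : 0 < a ->
  measurable_fun setT f -> (forall x, 0 <= f x)%E ->
  (\int[lebesgue_measure]_x f x =
   a%:E * \int[lebesgue_measure]_x f (a * x + b)%R)%E.
Proof.
move=> a0 mf f0.
have ma := measurable_affine a b.
rewrite (eq_measure_integral (affine_measure b a0)); last first.
  by move=> A mA _; 
    first [exact: (lebesgue_measure_affine b a0 mA)
          |exact: (esym (lebesgue_measure_affine b a0 mA))].
rewrite ge0_integral_mscale // ge0_integral_pushforward //.
Qed.

Lemma normal_prob_preimage (R : realType) (m s : R) (f : R -> R) (B : set R) :
  measurable_fun setT f -> measurable B ->
  normal_prob m s (f @^-1` B) =
  (\int[lebesgue_measure]_x (\1_B (f x) * normal_pdf m s x)%:E)%E.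
Proof.
move=> mf mB; rewrite /normal_prob integral_mkcond; apply: eq_integral => x _.
rewrite /patch indicE; case: ifPn; rewrite ?inE => h.
  by rewrite mem_set // mul1r.
by move/negP: h; rewrite inE => h; rewrite memNset // mul0r.
Qed.

(* The ratio of the densities of x + N(0, 1/2) and sigma N(0, 1/2) is bounded by
   sigma e^2, because y^2 / sigma^2 <= (y - x)^2 + 2. *)
Lemma normal_prob_shift_le (R : realType) (x sigma : R) (B : set R) :
  1 <= sigma -> 2 <= sigma ^+ 2 -> `|x| <= sigma -> measurable B ->
  (normal_prob 0 (Num.sqrt 2^-1) [set t | B (t + x)%R] <=
   (sigma * expR 2)%:E * normal_prob 0 (Num.sqrt 2^-1) [set t | B (sigma * t)%R])%E.
Proof.
move=> s1 s2 xs mB; have s0 : 0 < sigma by rewrite (lt_le_trans _ s1).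
have m1 : measurable_fun setT (fun t : R => t + x) by apply: measurable_funD.
have m2 : measurable_fun setT (fun t : R => sigma * t) by apply: measurable_funM.
rewrite (normal_prob_preimage _ _ m1 mB) (normal_prob_preimage _ _ m2 mB).
have mI (g : R -> R) : measurable_fun setT g -> measurable_fun setT
    (fun t : R => (\1_B (g t) : R)%R).
  move=> mg; apply: (measurableT_comp (f := (\1_B : R -> R))) => //.
(* The substitution t -> sigma t - x turns [B (t + x)] into [B (sigma * t)]; its Jacobian is the
   factor [sigma]. *)
rewrite (ge0_integral_affine (- x) s0) /=; first last.
- by move=> y; rewrite lee_fin mulr_ge0 // ?normal_pdf_ge0 // indicE.
- apply/measurable_EFinP; apply: measurable_funM; first exact: mI.
  exact: measurable_normal_pdf.
rewrite EFinM -muleA; apply: lee_pmul => //.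
- by rewrite lee_fin ltW.
- by apply: integral_ge0 => y _; rewrite lee_fin mulr_ge0 // ?normal_pdf_ge0 // indicE.
rewrite -ge0_integralZl_EFin //; last 2 first.
- by move=> y _; rewrite lee_fin mulr_ge0 // ?normal_pdf_ge0 // indicE.
- apply/measurable_EFinP; apply: measurable_funM; first exact: mI.
  exact: measurable_normal_pdf.
apply: ge0_le_integral => //.
- by move=> y _; rewrite lee_fin mulr_ge0 // ?normal_pdf_ge0 // indicE.
- apply/measurable_EFinP; apply: measurable_funM.
    apply: mI; by apply: measurable_funD => //; apply: measurable_funD.
  apply: (measurableT_comp (measurable_normal_pdf _ _)); apply: measurable_funD => //.
- apply/measurable_EFinP; apply: measurable_funM => //.
  apply: measurable_funM; first exact: mI.
  exact: measurable_normal_pdf.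
move=> t _; rewrite -EFinM lee_fin subrK mulrCA; apply: ler_wpM2l.
  by rewrite indicE.
have q0 : Num.sqrt 2^-1 != 0 :> R by rewrite gt_eqF // sqrtr_gt0 invr_gt0.
rewrite !normal_pdfE // mulrCA; apply: ler_wpM2l; first exact: normal_peak_ge0.
rewrite /normal_fun sqr_sqrtr ?invr_ge0 // !subr0 -expRD ler_expR.
rewrite -[2^-1 *+ 2]mulr_natr mulVf ?pnatr_eq0 // !divr1.
suff : t ^+ 2 <= (sigma * t - x) ^+ 2 + 2 by lra.
(* This is (p + q)^2 <= 2 p^2 + 2 q^2 with p = sigma t - x and q = x. Division by sigma^2 >= 2, with
   x^2 <= sigma^2, leaves the additive constant 2, hence the factor e^2. *)
have h : (sigma * t) ^+ 2 <= 2 * (sigma * t - x) ^+ 2 + 2 * x ^+ 2.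
  rewrite -subr_ge0; have -> : 2 * (sigma * t - x) ^+ 2 + 2 * x ^+ 2 - (sigma * t) ^+ 2
    = (sigma * t - 2 * x) ^+ 2 by ring.
  exact: sqr_ge0.
have xx : x ^+ 2 <= sigma ^+ 2.
  by rewrite -real_normK ?num_real // lerXn2r // nnegrE // ltW.
have ss : 0 < sigma ^+ 2 by rewrite exprn_gt0.
rewrite -(ler_pM2l ss); apply: (le_trans (y := 2 * (sigma * t - x) ^+ 2 + 2 * x ^+ 2)).
  by move: h; rewrite exprMn.
rewrite mulrDr; apply: lerD; last by rewrite mulrC ler_pM2r.
by apply: ler_wpM2r => //; exact: sqr_ge0.
Qed.

(** On [-1, 1] the density is its peak times exp(-t^2), hence at least its peak times exp(-1). *)
Lemma normal_prob_itv_ge (R : realType) : exists2 c : R, 0 < c &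
  forall a b : R, - 1 <= a -> a <= b -> b <= 1 ->
    ((c * (b - a))%:E <= normal_prob 0 (Num.sqrt 2^-1) `[a, b])%E.
Proof.
pose s : R := Num.sqrt 2^-1.
have q0 : s != 0 by rewrite gt_eqF // sqrtr_gt0 invr_gt0.
pose c : R := normal_peak s * expR (-1).
exists c; first by rewrite mulr_gt0 ?expR_gt0 // normal_peak_gt0.
move=> a b a1 ab b1.
have c0 : 0 <= c by rewrite mulr_ge0 ?expR_ge0 ?normal_peak_ge0.
have -> : ((c * (b - a))%:E = \int[lebesgue_measure]_(x in `[a, b]) (cst c%:E) x)%E.
  rewrite integral_cst //= lebesgue_measure_itv /= lte_fin.
  have [_|ba] := ltP a b; first by rewrite -EFinM.
  by rewrite (le_anti (introT andP (conj ab ba))) subrr mulr0 mule0.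
apply: ge0_le_integral => //.
- by apply: measurable_funTS; apply/measurable_EFinP; exact: measurable_normal_pdf.
move=> x /=; rewrite in_itv /= => /andP[ax xb].
rewrite lee_fin normal_pdfE //; apply: ler_wpM2l; first exact: normal_peak_ge0.
rewrite /normal_fun sqr_sqrtr ?invr_ge0 // subr0 ler_expR.
rewrite -[2^-1 *+ 2]mulr_natr mulVf ?pnatr_eq0 // divr1 lerN2.
rewrite -real_normK ?num_real // -(expr1n _ 2) lerXn2r ?nnegrE //.
by rewrite ler_norml; apply/andP; split; lra.
Qed.

(** * Independence and domination of shifted Gaussian vectors *)

(** The sets with preimage in [S] form a sigma-algebra. Complex blocks and coordinate families are
    handled through generated sigma-algebras, and measurability is transported between them in this
    form. *)
Lemma smallest_preimage (T U : Type) (G : set (set U)) (S : set (set T))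
    (f : T -> U) : sigma_algebra setT S ->
  (forall A, G A -> S (f @^-1` A)) -> forall A, <<s G >> A -> S (f @^-1` A).
Proof.
move=> [S0 SC SU] GS; have : <<s G >> `<=` [set A | S (f @^-1` A)]; last by [].
apply: smallest_sub => //; split.
- by rewrite /= preimage_set0.
- by move=> B /= SB; rewrite setTD preimage_setC -setTD; exact: SC.
- by move=> F SF; rewrite /= preimage_bigcup; exact: SU.
Qed.

Definition rectangles T1 T2 (A : set (set T1)) (B : set (set T2)) :
  set (set (T1 * T2)) := [set U `*` V | U in A & V in B].

Section decoupling.
Context (R : realType) (d : measure_display) (T : measurableType d).
Variables (P : probability T R) (SA SB : set (set T)).
Hypotheses (mA : SA `<=` measurable) (mB : SB `<=` measurable).

Lemma rectangles_measurable : <<s rectangles SA SB >> `<=` measurable.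
Proof.
apply: smallest_sub; first exact: sigma_algebra_measurable.
by move=> _ [U AU [V BV <-]]; apply: measurableX; [exact: mA|exact: mB].
Qed.

Hypotheses (AT : SA setT) (BT : SB setT).
Hypotheses (AI : setI_closed SA) (BI : setI_closed SB).
Hypothesis AB_indep : forall A B, SA A -> SB B -> P (A `&` B) = (P A * P B)%E.

(** The image of [P] under the diagonal and the product measure agree on rectangles by independence,
    hence on the sigma-algebra they generate. Stability under intersection is enough for [SA] and
    [SB], which need not be sigma-algebras. *)
Lemma decoupling (D : set (T * T)) : <<s rectangles SA SB >> D ->
  P [set w | D (w, w)] = (\int[P]_w P [set w' | D (w, w')])%E.
Proof.
move=> hD.
have mdiag : measurable_fun [set: T] (fun w : T => (w, w)).
  exact: measurable_fun_pair.
have -> : (\int[P]_w P [set w' | D (w, w')] = (P \x P)%E D)%E.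
  apply: eq_integral => w _; congr (P _).
  by apply/seteqP; split => w' /=; rewrite /xsection /= inE.
have -> : P [set w | D (w, w)] = pushforward_measure P mdiag D by [].
apply: (g_sigma_algebra_measure_unique (rectangles SA SB) _ (fun _ => setT)) => //.
- by move=> X XG; apply: rectangles_measurable; exact: sub_sigma_algebra.
- by move=> _; exists setT => //; exists setT => //; rewrite setXTT.
- by rewrite bigcup_const.
- move=> _ _ [U1 A1 [V1 B1 <-]] [U2 A2 [V2 B2 <-]]; rewrite -setXI.
  by exists (U1 `&` U2); [exact: AI|exists (V1 `&` V2) => //; exact: BI].
- move=> _ [U AU [V BV <-]].
  rewrite [RHS]product_measure1E; [|exact: mA|exact: mB].
  by rewrite -AB_indep.
- move=> _; rewrite /pushforward_measure /= /pushforward preimage_setT.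
  by rewrite probability_setT ltry.
Qed.

End decoupling.

Definition cylinders (R : realType) (I : Type) : set (set (I -> R)) :=
  [set C | exists i (B : set R), measurable B /\ C = (fun v => v i) @^-1` B].

Section gaussian_domination.
Context (R : realType) (d : measure_display) (T : measurableType d).
Variables (P : probability T R) (I : finType) (X : I -> T -> R).
Hypothesis mX : forall i, measurable_fun setT (X i).
Hypothesis lawX : forall i (B : set R), measurable B ->
  P (X i @^-1` B) = normal_prob 0 (Num.sqrt 2^-1) B.
Hypothesis indepX : mutually_independent P
  (fun i => preimage_set_system [set: T] (X i) measurable).

Lemma preimage_measurable i (B : set R) : measurable B -> measurable (X i @^-1` B).
Proof. by move=> mB; rewrite -[X in measurable X]setTI; exact: mX. Qed.

Lemma indep_bigcap (B : I -> set R) : (forall i, measurable (B i)) ->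
  P (\bigcap_i (X i @^-1` B i)) = (\prod_i P (X i @^-1` B i))%E.
Proof.
move=> mB.
have -> : [set: I] = [set i | i \in finset.setTfor I].
  by apply/seteqP; split => i //=; rewrite finset.in_setT.
rewrite indepX => [|i _]; last by exists (B i); [exact: mB|rewrite setTI].
by apply: eq_bigl => i; rewrite finset.in_setT.
Qed.

(* Independence lets the i0-th coordinate be resampled while the others are frozen. *)
Lemma replace_coordinate (i0 : I) (g g' : I -> R -> R) (K : R) :
  0 <= K ->
  (forall i, measurable_fun setT (g i)) -> (forall i, measurable_fun setT (g' i)) ->
  (forall i, i != i0 -> g i = g' i) ->
  (forall B, measurable B ->
    (P [set w | B (g i0 (X i0 w))] <= K%:E * P [set w | B (g' i0 (X i0 w))])%E) ->
  forall A, <<s @cylinders R I >> A ->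
  (P [set w | A (fun i => g i (X i w))] <=
   K%:E * P [set w | A (fun i => g' i (X i w))])%E.
Proof.
move=> K0 mg mg' gg' H A hA.
pose SB := [set X i0 @^-1` B | B in @measurable _ R].
(* [SA] holds the events of the coordinates other than [i0]: boxes whose [i0]-th side is the whole
   line. *)
pose SA := [set (\bigcap_i (X i @^-1` B i)) |
  B in [set B : I -> set R | (forall i, measurable (B i)) /\ B i0 = setT]].
have mSB : SB `<=` measurable by move=> _ [B mB <-]; exact: preimage_measurable.
have mSA : SA `<=` measurable.
  move=> _ [B [mB _] <-]; apply: fin_bigcap_measurable.
    exact: finite_finset.
  by move=> i _; exact: preimage_measurable.
have SAT : SA setT.
  exists (fun _ => setT); first by split.
  by apply/seteqP; split.
have SBT : SB setT by exists setT.
have SAI : setI_closed SA.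
  move=> _ _ [B [mB B0] <-] [C [mC C0] <-].
  exists (fun i => B i `&` C i).
    by split; [move=> i; exact: measurableI|rewrite B0 C0 setIT].
  by rewrite -bigcapI.
have SBI : setI_closed SB.
  by move=> _ _ [B mB <-] [C mC <-]; exists (B `&` C) => //; exact: measurableI.
have SI : forall A B, SA A -> SB B -> P (A `&` B) = (P A * P B)%E.
  move=> _ _ [B [mB B0] <-] [C mC <-].
  pose E i := if i == i0 then C else B i.
  have mE i : measurable (E i) by rewrite /E; case: ifP.
  have -> : \bigcap_i (X i @^-1` B i) `&` X i0 @^-1` C = \bigcap_i (X i @^-1` E i).
    apply/seteqP; split => w /=.
      move=> [h1 h2] i _; rewrite /E /=; case: eqP => [->//|_]; exact: h1.
    move=> h; split; last by have := h i0 Logic.I; rewrite /E eqxx.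
    move=> i _; have := h i Logic.I; rewrite /E; case: eqP => [->|//].
    by rewrite B0.
  rewrite !indep_bigcap // (bigD1 i0) //= [in RHS](bigD1 i0) //=.
  rewrite {1}/E eqxx B0 preimage_setT probability_setT mul1e muleC.
  by congr (_ * _)%E; apply: eq_bigr => i /negPf i0'; rewrite /E i0'.
pose D (h : R -> R) := [set p : T * T |
  A (fun i => if i == i0 then h (X i0 p.2) else g i (X i p.1))].
have hD h : measurable_fun setT h -> <<s rectangles SA SB >> (D h).
  move=> mh; rewrite /D.
  apply: (smallest_preimage (f := fun (p : T * T) i =>
    if i == i0 then h (X i0 p.2) else g i (X i p.1)) (G := @cylinders R I)
    (S := <<s rectangles SA SB >>)) => //.
  move=> _ [i [B [mB ->]]]; apply: sub_sigma_algebra.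
  rewrite /rectangles /=; case: (eqVneq i i0) => [->|ii0].
    exists setT => //; exists (X i0 @^-1` (h @^-1` B)).
      by exists (h @^-1` B) => //; rewrite -[X in measurable X]setTI; exact: mh.
    by apply/seteqP; split => -[w w'] /=; rewrite eqxx //; case.
  exists (X i @^-1` (g i @^-1` B)).
    exists (fun j => if j == i then g i @^-1` B else setT).
      split; last by rewrite eq_sym (negPf ii0).
      move=> j; case: ifP => // _; rewrite -[X in measurable X]setTI; exact: mg.
    apply/seteqP; split => w /=; first by move=> /(_ i Logic.I); rewrite eqxx.
    by move=> h' j _ /=; case: eqP => [->|].
  exists setT => //.
  by apply/seteqP; split => -[w w'] /=; rewrite (negPf ii0) //; case.
have E h (f : I -> R -> R) : f i0 = h -> (forall i, i != i0 -> f i = g i) ->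
    measurable_fun setT h ->
    P [set w | A (fun i => f i (X i w))] =
    (\int[P]_w P [set w' | D h (w, w')])%E.
  move=> f0 fi mh; rewrite -(decoupling mSA mSB SAT SBT SAI SBI SI (hD _ mh)).
  congr (P _); apply/seteqP; split => w; rewrite /D /=; congr A; apply/funext => i;
    by case: eqP => [->|/eqP/fi->] //; rewrite f0.
have mP h : measurable_fun setT h ->
    measurable_fun setT (fun w => P [set w' | D h (w, w')]).
  move=> mh; have -> : (fun w => P [set w' | D h (w, w')]) = P \o xsection (D h).
    apply/funext => w /=; congr (P _).
    by apply/seteqP; split => w' /=; rewrite /xsection /= inE.
  by apply: measurable_fun_xsection; apply: (rectangles_measurable mSA mSB); exact: hD.
rewrite (E (g i0) g) // (E (g' i0) g') //; last by move=> i /gg'.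
rewrite -ge0_integralZl_EFin //; last exact: mP.
apply: ge0_le_integral => //; first exact: mP.
  by apply: measurable_funeM; exact: mP.
move=> w _; rewrite /D /=.
(* With the other coordinates frozen at [w], the event is a Borel set of the resampled coordinate,
   so [H] bounds the integrand pointwise. *)
pose B := [set t | A (fun i => if i == i0 then t else g i (X i w))].
apply: (H B).
apply: (smallest_preimage (f := fun (t : R) i =>
    if i == i0 then t else g i (X i w)) (G := @cylinders R I)
    (S := @measurable _ R)) => //.
  exact: sigma_algebra_measurable.
move=> _ [i [C [mC ->]]].
case: (eqVneq i i0) => [->|ii0].
  by rewrite (_ : _ @^-1` _ = C) //; apply/seteqP; split => t /=; rewrite eqxx.
have [h|h] := pselect (C (g i (X i w))).
  rewrite (_ : _ @^-1` _ = setT) //.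
  by apply/seteqP; split => t /=; rewrite (negPf ii0).
by rewrite (_ : _ @^-1` _ = set0) //; apply/seteqP; split => t /=; rewrite (negPf ii0).
Qed.

(** A hybrid argument: coordinates in the list [s] are already scaled, the others still shifted, and
    each further coordinate costs one factor [sigma * expR 2]. *)
Lemma gaussian_shift_le (x : I -> R) (sigma : R) :
  1 <= sigma -> 2 <= sigma ^+ 2 -> (forall i, `|x i| <= sigma) ->
  forall A, <<s @cylinders R I >> A ->
  (P [set w | A (fun i => X i w + x i)%R] <=
   ((sigma * expR 2) ^+ #|I|)%:E * P [set w | A (fun i => sigma * X i w)%R])%E.
Proof.
move=> s1 s2 xs A hA.
have K0 : 0 <= sigma * expR 2 by rewrite mulr_ge0 ?expR_ge0 // (le_trans _ s1).
pose g (s : seq I) i (t : R) := if i \in s then sigma * t else t + x i.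
have mg s i : measurable_fun setT (g s i).
  by rewrite /g; case: (i \in s); [exact: measurable_funM|exact: measurable_funD].
have key s : uniq s -> (P [set w | A (fun i => g [::] i (X i w))] <=
   ((sigma * expR 2) ^+ size s)%:E * P [set w | A (fun i => g s i (X i w))])%E.
  elim: s => [|i s IH] /=; first by rewrite expr0 mul1e.
  case/andP => is_ us; apply: (le_trans (IH us)).
  rewrite exprSr EFinM -muleA; apply: lee_wpmul2l.
    by rewrite lee_fin exprn_ge0.
  apply: (replace_coordinate (i0 := i)) => //.
    by move=> j ji; apply/funext => t; rewrite /g in_cons (negPf ji).
  move=> B mB; rewrite /g (negPf is_) mem_head.
  have := normal_prob_shift_le s1 s2 (xs i) mB.
  have m1 : measurable [set t | B (t + x i)%R].
    have : measurable_fun setT (fun t : R => t + x i) by apply: measurable_funD.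
    by move=> /(_ measurableT _ mB); rewrite setTI.
  have m2 : measurable [set t | B (sigma * t)%R].
    have : measurable_fun setT (fun t : R => sigma * t) by apply: measurable_funM.
    by move=> /(_ measurableT _ mB); rewrite setTI.
  by rewrite -(lawX i m1) -(lawX i m2).
have := key _ (enum_uniq I); rewrite -cardE /g.
set F := (fun w => A (fun i => if _ then _ else _)).
suff -> : F = (fun w => A (fun i => sigma * X i w)) by [].
by apply/funext => w; congr A; apply/funext => i; rewrite mem_enum.
Qed.

End gaussian_domination.

(** * Complex noise vectors and packing *)

Lemma sigma_algebra_setI (U : Type) (S : set (set U)) :
  sigma_algebra setT S -> setI_closed S.
Proof. by move=> /sigma_algebraP [//|_ _ _]; apply. Qed.

Lemma sigma_algebra_forall (U : Type) (S : set (set U)) (I : finType)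
    (F : I -> set U) : sigma_algebra setT S -> (forall i, S (F i)) ->
  S [set u | forall i, F i u].
Proof.
move=> sS SF; have ST : S setT by case/sigma_algebraP: sS.
suff H (s : seq I) : S [set u | forall i, i \in s -> F i u].
  by have := H (enum I); congr S; apply/seteqP; split => u /= h i;
    [apply: h; rewrite mem_enum|move=> _; exact: h].
elim: s => [|i s IH].
  by rewrite (_ : [set u | _] = setT) //; apply/seteqP; split.
rewrite (_ : [set u | _] = F i `&` [set u | forall i, i \in s -> F i u]).
  exact: sigma_algebra_setI.
apply/seteqP; split => u /= h.
  by split; [apply: h; rewrite mem_head|move=> k ks; apply: h; rewrite in_cons ks orbT].
by move=> k; rewrite in_cons => /orP[/eqP ->|]; [exact: h.1|exact: h.2].
Qed.

Local Notation normc := ComplexField.Normc.normc.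

Section real_valued_probability.
Context (R : realType) (d : measure_display) (T : measurableType d).
Variable P : probability T R.

Definition pr (A : set T) : R := fine (P A).

Lemma prE (A : set T) : measurable A -> (pr A)%:E = P A.
Proof. by move=> mA; rewrite /pr fineK // fin_num_measure. Qed.

Lemma pr_ge0 (A : set T) : 0 <= pr A.
Proof. exact: fine_ge0. Qed.

Lemma prC (A : set T) : measurable A -> pr (~` A) = 1 - pr A.
Proof.
move=> mA; apply: EFin_inj; rewrite prE ?probability_setC //; last exact: measurableC.
by rewrite EFinB prE.
Qed.

Lemma pr_setI_ge (A B : set T) : measurable A -> measurable B ->
  pr A - pr (~` B) <= pr (A `&` B).
Proof.
move=> mA mB; rewrite lerBlDr -lee_fin EFinD !prE //; first last.
- exact: measurableI.
- exact: measurableC.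
apply: le_trans (measureU2 _ _ _); [|exact: measurableI|exact: measurableC].
apply: le_measure; rewrite ?inE //.
  by apply: measurableU; [exact: measurableI|exact: measurableC].
by move=> w Aw; case: (pselect (B w)) => Bw; [left|right].
Qed.

(** The sum is the expected number of events that occur, and that number never exceeds [L]. *)
Lemma sum_pr_le (J : finType) (E : J -> set T) (L : R) :
  (forall j, measurable (E j)) -> (forall w, \sum_j (\1_(E j) w : R) <= L) ->
  \sum_j pr (E j) <= L.
Proof.
move=> mE EL; rewrite -lee_fin -sumEFin.
rewrite (eq_bigr (fun j => \int[P]_w (\1_(E j) w)%:E)%E) => [|j _]; last first.
  by rewrite integral_indic // setIT prE.
rewrite -ge0_integral_sum //; last first.
  by move=> j; exact/measurable_EFinP.
apply: (@le_trans _ _ (\int[P]_w L%:E)%E).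
  apply: ge0_le_integral => //.
  - by move=> w _; apply: sume_ge0 => j _; rewrite lee_fin.
  - apply: emeasurable_sum => j; exact/measurable_EFinP.
  - by move=> w _; rewrite sumEFin lee_fin.
by rewrite integral_cst //= probability_setT mule1.
Qed.

End real_valued_probability.

Lemma sigma_genT (R : realType) (X I : Type) (f : I -> X -> R[i]) :
  sigma_gen f setT.
Proof.
by have /sigma_algebraP[] := smallest_sigma_algebra setT
  [set A | exists (p : I * bool) (B : set R), measurable B /\ A = reim f p @^-1` B].
Qed.

Section complex_vectors.
Context (R : realType) (N : nat).
Local Open Scope complex_scope.
Implicit Types v x o : 'cV[R[i]]_N.

Definition vcoord (k : 'I_N) v : R[i] := v k 0.

Definition vec_measurable : set (set 'cV[R[i]]_N) := sigma_gen vcoord.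

Lemma normcD (a b : R[i]) : normc (a + b) <= normc a + normc b.
Proof. exact: le_normcD. Qed.

Lemma normc_ge_reim (a : R[i]) (b : bool) :
  `|if b then complex.Im a else complex.Re a| <= normc a.
Proof.
case: a => x y /=; rewrite -sqrtr_sqr ler_sqrt ?addr_ge0 ?sqr_ge0 //.
by case: b; rewrite ?lerDl ?lerDr sqr_ge0.
Qed.

Lemma normc_ge0 (a : R[i]) : 0 <= normc a.
Proof. by case: a => x y; exact: sqrtr_ge0. Qed.

Lemma normc_le_reim (a : R[i]) (r : R) :
  (forall b : bool, `|if b then complex.Im a else complex.Re a| <= r) ->
  normc a <= 2 * r.
Proof.
move=> h; have h1 := h false; have h2 := h true; move: h1 h2 => {h}.
case: a => x y /= hx hy; have r0 : 0 <= r := le_trans (normr_ge0 _) hx.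
rewrite -(ger0_norm (mulr_ge0 (ler0n R 2) r0)) -sqrtr_sqr; apply: ler_wsqrtr.
have q (t : R) : `|t| <= r -> t ^+ 2 <= r ^+ 2.
  by move=> tr; rewrite -real_normK ?num_real // lerXn2r // nnegrE.
have := q _ hx; have := q _ hy; rewrite exprMn; nra.
Qed.

Lemma vec_measurable_preimage (U : Type) (S : set (set U))
    (f : U -> 'cV[R[i]]_N) : sigma_algebra setT S ->
  (forall p B, measurable B -> S ((fun u => reim vcoord p (f u)) @^-1` B)) ->
  forall A, vec_measurable A -> S (f @^-1` A).
Proof.
move=> sS H; apply: smallest_preimage => // _ [p [B [mB ->]]]; exact: H.
Qed.

Lemma vec_measurableI A B :
  vec_measurable A -> vec_measurable B -> vec_measurable (A `&` B).
Proof. exact: sigma_algebra_setI (smallest_sigma_algebra _ _) _ _. Qed.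

Definition vec_box (r : R) v : set 'cV[R[i]]_N :=
  [set y | forall k, forall b : bool,
     `|reim vcoord (k, b) y - reim vcoord (k, b) v| <= r].

Lemma vec_box_measurable r v : vec_measurable (vec_box r v).
Proof.
have -> : vec_box r v = [set y | forall p, `|reim vcoord p y - reim vcoord p v| <= r].
  apply/seteqP; split => y /= h; first by move=> [k b]; exact: h.
  by move=> k b; apply: (h (k, b)).
apply: (sigma_algebra_forall (smallest_sigma_algebra _ _)) => p.
apply: sub_sigma_algebra; exists p.
exists `[reim vcoord p v - r, reim vcoord p v + r]%classic.
split; first exact: measurable_itv.
apply/seteqP; split => y /=; rewrite in_itv /= ler_norml.
  by case/andP => h1 h2; apply/andP; split; lra.
by case/andP => h1 h2; apply/andP; split; lra.
Qed.

(** Each real coordinate differs by at most 2r, and passing from the two parts to the modulus costs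
    another factor 2. *)
Lemma vec_box_dist r v1 v2 y : vec_box r v1 y -> vec_box r v2 y ->
  forall k, normc (v1 k 0 - v2 k 0) <= 4 * r.
Proof.
move=> h1 h2 k; have -> : 4 * r = 2 * (2 * r) by ring.
apply: normc_le_reim => b; have := h1 k b; have := h2 k b.
rewrite /reim /vcoord /=.
have -> : (if b then complex.Im (v1 k 0 - v2 k 0) else complex.Re (v1 k 0 - v2 k 0))
   = (if b then complex.Im (v1 k 0) else complex.Re (v1 k 0)) -
     (if b then complex.Im (v2 k 0) else complex.Re (v2 k 0)).
  by case: b; case: (v1 k 0) (v2 k 0) => [? ?] [? ?].
by rewrite !ler_norml => /andP[? ?] /andP[? ?]; apply/andP; split; lra.
Qed.

End complex_vectors.

Section noise.
Context (R : realType) (d : measure_display) (T : measurableType d).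
Variables (P : probability T R) (N : nat) (z : T -> 'cV[R[i]]_N).
Hypothesis hz : std_CN P (fun (k : 'I_N) w => z w k 0).
Local Open Scope complex_scope.
Implicit Types (v x o : 'cV[R[i]]_N) (A : set 'cV[R[i]]_N).

Let X (p : 'I_N * bool) (w : T) : R := reim (fun (k : 'I_N) w => z w k 0) p w.

Let vec_of (f : 'I_N * bool -> R) : 'cV[R[i]]_N :=
  \col_k (f (k, false) +i* f (k, true)).

Let reim_vec_of f o p :
  reim (@vcoord R N) p (vec_of f + o) = f p + reim (@vcoord R N) p o.
Proof.
case: p => k b; rewrite /reim /vcoord /= !mxE.
by case: b; case: (o k 0).
Qed.

Let vec_of_measurable o A : vec_measurable A ->
  <<s @cylinders R ('I_N * bool)%type >> [set f | A (vec_of f + o)].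
Proof.
move=> hA; apply: (vec_measurable_preimage (f := fun f => vec_of f + o)
  (S := <<s @cylinders R ('I_N * bool)%type >>)) => //.
move=> p B mB; apply: sub_sigma_algebra.
exists p, [set t | B (t + reim (@vcoord R N) p o)]; split.
  have : measurable_fun setT (fun t : R => t + reim (@vcoord R N) p o).
    by apply: measurable_funD.
  by move=> /(_ measurableT _ mB); rewrite setTI.
by apply/seteqP; split => f /=; rewrite reim_vec_of.
Qed.

Lemma measurable_noise_preimage x A : vec_measurable A ->
  measurable [set w | A (z w + x)].
Proof.
move=> hA; apply: (vec_measurable_preimage (f := fun w => z w + x)
  (S := @measurable _ T)) => //; first exact: sigma_algebra_measurable.
case: hz => mz _ _ p B mB; rewrite -[X in measurable X]setTI.
have -> : (fun u => reim (@vcoord R N) p (z u + x)) =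
    (fun u => X p u + reim (@vcoord R N) p x).
  apply/funext => u; rewrite /X /reim /vcoord !mxE.
  by case: p => k b /=; case: b; case: (z u k 0) (x k 0) => [? ?] [? ?].
by apply: measurable_funD => //; exact: mz.
Qed.

Lemma measurable_scaled_noise_preimage (sigma : R) x A : vec_measurable A ->
  measurable [set w | A (sigma%:C *: z w + x)].
Proof.
move=> hA; apply: (vec_measurable_preimage (f := fun w => sigma%:C *: z w + x)
  (S := @measurable _ T)) => //; first exact: sigma_algebra_measurable.
case: hz => mz _ _ p B mB; rewrite -[X in measurable X]setTI.
have -> : (fun u => reim (@vcoord R N) p (sigma%:C *: z u + x)) =
    (fun u => sigma * X p u + reim (@vcoord R N) p x).
  apply/funext => u; rewrite /X /reim /vcoord !mxE.
  by case: p => k b /=; case: b; case: (z u k 0) (x k 0) => [? ?] [? ?] /=; ring.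
by apply: measurable_funD => //; apply: measurable_funM => //; exact: mz.
Qed.

(** One factor for each of the 2N real coordinates of a complex block. *)
Definition shift_cost (sigma : R) : R := (sigma * expR 2) ^+ (N * 2).

(** The offset [o] stays on both sides, so all codewords [x + o] with coordinates within [sigma] of
    the centre [o] are compared with one law, free of [x]. *)
Lemma noise_shift_le (sigma : R) x o A :
  1 <= sigma -> 2 <= sigma ^+ 2 -> (forall k, normc (x k 0) <= sigma) ->
  vec_measurable A ->
  pr P [set w | A (z w + (x + o))] <=
  shift_cost sigma * pr P [set w | A (sigma%:C *: z w + o)].
Proof.
move=> s1 s2 xs hA; case: (hz) => mz lz iz.
rewrite -lee_fin EFinM !prE; first last.
- exact: measurable_noise_preimage.
- exact: measurable_scaled_noise_preimage.
have xs' p : `|reim (@vcoord R N) p x| <= sigma.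
  by case: p => k b; apply: le_trans (xs k); exact: normc_ge_reim.
have := gaussian_shift_le (X := X) mz lz iz s1 s2 xs' (vec_of_measurable o hA).
rewrite card_prod card_ord card_bool /=.
have -> : [set w | A (vec_of (fun i => X i w + reim (@vcoord R N) i x) + o)] =
    [set w | A (z w + (x + o))].
  apply/seteqP; split => w /=; congr A; rewrite addrA; congr (_ + _);
  apply/matrixP => k j; rewrite !mxE (ord1 j) /X /reim /vcoord /=;
  by case: (z w k 0) (x k 0) => [? ?] [? ?].
have -> : [set w | A (vec_of (fun i => sigma * X i w) + o)] =
    [set w | A (sigma%:C *: z w + o)].
  apply/seteqP; split => w /=; congr A; congr (_ + _);
  apply/matrixP => k j; rewrite !mxE (ord1 j) /X /reim /vcoord /=;
  by case: (z w k 0) => [? ?] /=; simpc.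
by [].
Qed.

Lemma shift_cost_ge0 sigma : 0 <= sigma -> 0 <= shift_cost sigma.
Proof. by move=> s0; rewrite exprn_ge0 // mulr_ge0 ?expR_ge0. Qed.

(** After domination every region is tested against the same widened noise around [o]; disjoint
    regions then have total probability at most 1. *)
Lemma packing (J : finType) (v : J -> 'cV[R[i]]_N) o
    (A : J -> set 'cV[R[i]]_N) (sigma : R) :
  1 <= sigma -> 2 <= sigma ^+ 2 ->
  (forall j k, normc (v j k 0 - o k 0) <= sigma) ->
  (forall j, vec_measurable (A j)) ->
  (forall i j y, A i y -> A j y -> i = j) ->
  \sum_j pr P [set w | A j (z w + v j)] <= shift_cost sigma.
Proof.
move=> s1 s2 vs mA tA.
apply: (@le_trans _ _ (\sum_j shift_cost sigma *
    pr P [set w | A j (sigma%:C *: z w + o)])).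
  apply: ler_sum => j _; rewrite -{1}[v j](subrK o).
  by apply: noise_shift_le => // k; rewrite !mxE.
rewrite -mulr_sumr -[leRHS]mulr1; apply: ler_wpM2l.
  by apply: shift_cost_ge0; exact: le_trans s1.
apply: sum_pr_le => [j|w]; first exact: measurable_scaled_noise_preimage.
have [[j Aj]|nA] := pselect (exists j, A j (sigma%:C *: z w + o)).
  rewrite (bigD1 j) //= big1 ?addr0; first by rewrite indicE; case: (_ \in _).
  move=> i ij; rewrite indicE memNset //= => Ai.
  by move: ij; rewrite (tA i j _ Ai Aj) eqxx.
rewrite big1 // => j _; rewrite indicE memNset //= => Aj; apply: nA.
by exists j.
Qed.

(** The complements of growing boxes decrease to the empty set, so continuity from above applies. *)
Lemma noise_tight (e : R) : 0 < e ->
  exists2 rho : R, 0 < rho & pr P (~` [set w | vec_box rho 0 (z w)]) <= e.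
Proof.
move=> e0.
pose F (n : nat) := ~` [set w | vec_box n.+1%:R 0 (z w)].
have mF n : measurable (F n).
  apply: measurableC.
  have := measurable_noise_preimage 0 (vec_box_measurable n.+1%:R 0).
  by under eq_set do rewrite addr0.
have niF : nonincreasing_seq F.
  move=> m n mn; apply/subsetPset => w /= nb bm; apply: nb => k b.
  by apply: le_trans (bm k b) _; rewrite ler_nat.
have F0 : \bigcap_n F n = set0.
  apply/seteqP; split => // w /= h.
  pose B := \sum_(k < N) \sum_(b : bool) `|reim (@vcoord R N) (k, b) (z w)|.
  have [n Bn] : exists n : nat, B <= n.+1%:R.
    exists (Num.truncn B); apply: ltW; exact: truncnS_gt.
  apply: (h n Logic.I) => k b.
  have -> : reim (@vcoord R N) (k, b) (0 : 'cV[R[i]]_N) = 0.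
    by rewrite /reim /vcoord /= mxE; case: b.
  rewrite subr0; apply: le_trans Bn; rewrite /B (bigD1 k) //= (bigD1 b) //=.
  rewrite -addrA lerDl addr_ge0 ?sumr_ge0 // => i _; exact: sumr_ge0.
have PF0 : (P (F 0%N) < +oo)%E by rewrite (le_lt_trans (probability_le1 _ _)) ?ltry.
have := nonincreasing_cvg_mu PF0 mF (bigcap_measurableType (fun k _ => mF k)) niF.
rewrite F0 measure0.
move=> /fine_cvgP [_] /cvgrPdist_le /(_ e e0) [n _ /(_ n (leqnn n))] /=.
rewrite sub0r normrN => hn; exists n.+1%:R => //.
by apply: le_trans hn; exact: ler_norm.
Qed.

End noise.

(** * Decoding and list decoding for frozen fading *)

Section single_user.
Context (R : realType) (d : measure_display) (T : measurableType d).
Variables (P : probability T R) (N : nat) (z : T -> 'cV[R[i]]_N).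
Hypothesis hz : std_CN P (fun (k : 'I_N) w => z w k 0).
Variables (M : nat) (D : 'cV[R[i]]_N -> 'I_M).
Hypothesis mD : forall m, vec_measurable [set y | D y = m].

Lemma pr_correct v m :
  pr P [set w | D (z w + v) = m] = 1 - pr P [set w | D (z w + v) <> m].
Proof.
rewrite -[in RHS]/(~` [set w | D (z w + v) = m]) prC ?subKr //.
exact: (measurable_noise_preimage hz v (mD m)).
Qed.

Lemma single_user_bound (v : 'I_M -> 'cV[R[i]]_N) (o : 'cV[R[i]]_N) (sigma : R) :
  1 <= sigma -> 2 <= sigma ^+ 2 ->
  (forall j k, normc (v j k 0 - o k 0) <= sigma) ->
  M%:R - \sum_j pr P [set w | D (z w + v j) <> j] <= shift_cost N sigma.
Proof.
move=> s1 s2 vs.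
have tD i j y : [set y | D y = i] y -> [set y | D y = j] y -> i = j by move=> <- <-.
have := packing hz s1 s2 vs mD tD.
rewrite (eq_bigr (fun j => 1 - pr P [set w | D (z w + v j) <> j])); last first.
  by move=> j _; exact: pr_correct.
by rewrite sumrB sumr_const card_ord.
Qed.

End single_user.

Section joint_bound.
Context (R : realType) (d : measure_display) (T : measurableType d).
Variables (P : probability T R) (N : nat) (z1 z2 : T -> 'cV[R[i]]_N).
Hypothesis hz1 : std_CN P (fun (k : 'I_N) w => z1 w k 0).
Hypothesis hz2 : std_CN P (fun (k : 'I_N) w => z2 w k 0).
Variables (M1 M2 : nat) (D1 : 'cV[R[i]]_N -> 'I_M1) (D2 : 'cV[R[i]]_N -> 'I_M2).
Hypothesis mD1 : forall m, vec_measurable [set y | D1 y = m].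
Hypothesis mD2 : forall m, vec_measurable [set y | D2 y = m].
Variables v1 v2 : 'I_M1 -> 'I_M2 -> 'cV[R[i]]_N.
Variables sigma1 sigma2 rho : R.
Hypotheses (s11 : 1 <= sigma1) (s12 : 2 <= sigma1 ^+ 2).
Hypotheses (s21 : 1 <= sigma2) (s22 : 2 <= sigma2 ^+ 2).
Hypothesis v1_bound : forall m1 m2 k, normc (v1 m1 m2 k 0) <= sigma1.
Hypothesis v2_bound : forall m1 m2 m2',
  (forall k, normc (v1 m1 m2 k 0 - v1 m1 m2' k 0) <= 4 * rho) ->
  forall k, normc (v2 m1 m2 k 0 - v2 m1 m2' k 0) <= sigma2.
Hypothesis z1_tight : pr P (~` [set w | vec_box rho 0 (z1 w)]) <= 8^-1.

Let e1 m1 m2 := pr P [set w | D1 (z1 w + v1 m1 m2) <> m1].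
Let e2 m1 m2 := pr P [set w | D2 (z2 w + v2 m1 m2) <> m2].
Let good m1 m2 := e2 m1 m2 <= 2^-1.

Let A m1 m2 := [set y | D1 y = m1] `&` vec_box rho (v1 m1 m2).

Let mA m1 m2 : vec_measurable (A m1 m2).
Proof. by apply: vec_measurableI; [exact: mD1|exact: vec_box_measurable]. Qed.

(** The region of a good pair, evaluated at the widened noise. That word does not depend on the
    pair, so the pairs accepted by one and the same received word can be counted. *)
Let E (p : 'I_M1 * 'I_M2) : set T :=
  if good p.1 p.2 then [set w | A p.1 p.2 (sigma1%:C%C *: z1 w + 0)] else set0.

Let mE p : measurable (E p).
Proof.
rewrite /E; case: ifP => _ //.
exact: (measurable_scaled_noise_preimage hz1 sigma1 0 (mA p.1 p.2)).
Qed.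

(* Given the first message and a point close to the first received word, the
   second message ranges over a list on which the codewords seen by the second
   receiver lie in one small ball; as it decodes the good ones, the list is short. *)
Let list_size w : \sum_p (\1_(E p) w : R) <= 2 * shift_cost N sigma2.
Proof.
pose y := sigma1%:C%C *: z1 w + 0; pose m1 := D1 y.
have EP p : E p w -> [/\ good p.1 p.2, p.1 = m1 & vec_box rho (v1 m1 p.2) y].
  by rewrite /E; case: ifP => // gp [/= h hb]; rewrite -/y in h hb; rewrite /m1 h.
rewrite -(pair_bigA _ (fun i j => (\1_(E (i, j)) w : R))) /=.
rewrite (bigD1 m1) //= [X in _ + X]big1 ?addr0; last first.
  move=> i im; rewrite big1 // => j _; rewrite indicE memNset //.
  by move=> /EP [_ /= ii _]; move: im; rewrite ii eqxx.
have c0 : 0 <= 2 * shift_cost N sigma2.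
  by rewrite mulr_ge0 // shift_cost_ge0 // (le_trans _ s21).
have [[j0 Ej0]|nE] := pselect (exists j, E (m1, j) w); last first.
  by rewrite big1 // => j _; rewrite indicE memNset // => Ej; apply: nE; exists j.
pose S j := `[< E (m1, j) w >].
(* Messages off the list get the empty region and the reference codeword [v2 m1 j0], so that packing
   applies to the whole index type. *)
pose B j := if S j then [set y | D2 y = j] else set0.
pose u j := if S j then v2 m1 j else v2 m1 j0.
have us j k : normc (u j k 0 - v2 m1 j0 k 0) <= sigma2.
  rewrite /u; case: ifP => [/asboolP Ej|_].
    have [_ _ b1] := EP _ Ej; have [_ _ b0] := EP _ Ej0.
    by apply: v2_bound; exact: vec_box_dist b1 b0.
  by rewrite subrr ComplexField.Normc.normc0 (le_trans _ s21).
have mB j : vec_measurable (B j).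
  by rewrite /B; case: ifP => _; [exact: mD2|exact: sigma_algebra0].
have tB i j x : B i x -> B j x -> i = j.
  by rewrite /B; case: ifP => // _ /= <-; case: ifP => // _ /= <-.
have := packing hz2 s21 s22 us mB tB.
rewrite -(ler_pM2l (ltr0n R 2)) mulr_sumr; apply: le_trans.
apply: ler_sum => j _; rewrite indicE /B /u.
case: (pselect (E (m1, j) w)) => Ej; last first.
  by rewrite memNset // mulr_ge0 // pr_ge0.
rewrite mem_set // /S asboolT // (pr_correct hz2 mD2) -/(e2 m1 j).
by have [gp _ _] := EP _ Ej; move: gp; rewrite /good /=; lra.
Qed.

(** Domination at receiver 1 costs [shift_cost N sigma1], and each received word accepts at most
    [2 * shift_cost N sigma2] good pairs. Summed over the M1 M2 pairs, the weights leave at least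
    7/8 - 7/32 - 1/8 = 17/32 of them on the left, more than the half that the constant 4 needs. *)
Lemma joint_bound :
  \sum_m1 \sum_m2 e1 m1 m2 <= (M1 * M2)%:R / 8 ->
  \sum_m1 \sum_m2 e2 m1 m2 <= (M1 * M2)%:R / 8 ->
  (M1 * M2)%:R <= 4 * shift_cost N sigma1 * shift_cost N sigma2.
Proof.
move=> h1 h2.
have k1 : 0 <= shift_cost N sigma1 by rewrite shift_cost_ge0 // (le_trans _ s11).
(* For a good pair the region has probability at least 1 - [e1] - 1/8. The weight 7/4 makes the left
   side negative as soon as [e2] exceeds 1/2, so bad pairs need no region. *)
have key p : 7 / 8 - 7 / 4 * e2 p.1 p.2 - e1 p.1 p.2 <=
    shift_cost N sigma1 * pr P (E p).
  have e10 : 0 <= e1 p.1 p.2 := pr_ge0 _ _.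
  have e20 : 0 <= e2 p.1 p.2 := pr_ge0 _ _.
  rewrite /E; case: ifP => [gp|/negbT]; last first.
    by rewrite /good -ltNge => gp; rewrite /pr measure0 /= mulr0; lra.
  have vk k : normc (v1 p.1 p.2 k 0) <= sigma1 by exact: v1_bound.
  apply: le_trans (noise_shift_le hz1 0 s11 s12 vk (mA p.1 p.2)).
  have -> : [set w | A p.1 p.2 (z1 w + (v1 p.1 p.2 + 0))] =
      [set w | D1 (z1 w + v1 p.1 p.2) = p.1] `&` [set w | vec_box rho 0 (z1 w)].
    rewrite addr0; apply/seteqP; split => w [h hb]; split => // k b;
      have := hb k b; rewrite /reim /vcoord !mxE;
      by case: b; case: (z1 w k 0) (v1 p.1 p.2 k 0) => [? ?] [? ?] /=;
        rewrite ?addrK ?subr0.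
  apply: le_trans (pr_setI_ge _ _ _) => //; first last.
  - have := measurable_noise_preimage hz1 0 (vec_box_measurable rho 0).
    by under eq_set do rewrite addr0.
  - exact: (measurable_noise_preimage hz1 (v1 p.1 p.2) (mD1 p.1)).
  rewrite (pr_correct hz1 mD1) -/(e1 p.1 p.2).
  by move: z1_tight; lra.
have : \sum_p (7 / 8 - 7 / 4 * e2 p.1 p.2 - e1 p.1 p.2) <=
    shift_cost N sigma1 * (2 * shift_cost N sigma2).
  apply: le_trans (ler_sum _ (fun p _ => key p)) _.
  rewrite -mulr_sumr ler_wpM2l //.
  by apply: sum_pr_le; [exact: mE|exact: list_size].
rewrite !sumrB sumr_const card_prod !card_ord -mulr_sumr.
rewrite -(pair_bigA _ (fun i j => e1 i j)) -(pair_bigA _ (fun i j => e2 i j)) /=.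
rewrite -[_ *+ (M1 * M2)]mulr_natr; move: h1 h2.
set a := (X in X <= _ -> _); set b := (X in _ -> X <= _ -> _).
rewrite mulrCA -[4 * _ * _]mulrA; move: (shift_cost N sigma1 * _) => k ha hb h.
have {}h : 7 / 8 * (M1 * M2)%:R - 7 / 4 * b - a <= 2 * k := h.
have : 0 <= (M1 * M2)%:R :> R by exact: ler0n.
by move: a b (M1 * M2)%:R ha hb h => a b c; lra.
Qed.

End joint_bound.

(** * Freezing the fading coefficients *)

Section receiver.
Context (R : realType) (d : measure_display) (T : measurableType d).
Variables (P : probability T R) (N : nat) (ha hb : T -> R[i]).
Variable z : T -> 'cV[R[i]]_N.
Local Notation sigma_a := (sigma_gen (fun _ : unit => ha)).
Local Notation sigma_b := (sigma_gen (fun _ : unit => hb)).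
Local Notation sigma_z := (sigma_gen (fun (k : 'I_N) w => z w k 0)).
Hypothesis ha_CN : std_CN P (fun _ : unit => ha).
Hypothesis hb_CN : std_CN P (fun _ : unit => hb).
Hypothesis hz : std_CN P (fun (k : 'I_N) w => z w k 0).
Hypothesis indep : forall A B C, sigma_a A -> sigma_b B -> sigma_z C ->
  P (A `&` B `&` C) = (P A * P B * P C)%E.

(** The SNR amplitudes are absorbed into [xa] and [xb], and transmitter 1 always comes first, so
    both receivers are instances of one model. *)
Definition receiver_obs (a b : R[i]) (xa xb z : 'cV[R[i]]_N) : observation R N :=
  (a *: xa + b *: xb + z, hvec a b).

Lemma sigma_gen_measurable (I : Type) (f : I -> T -> R[i]) :
  (forall p, measurable_fun setT (reim f p)) -> sigma_gen f `<=` measurable.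
Proof.
move=> mf; apply: smallest_sub; first exact: sigma_algebra_measurable.
by move=> _ [p [B [mB ->]]]; rewrite -[X in measurable X]setTI; exact: mf.
Qed.

Let sigmaI (I : Type) (f : I -> T -> R[i]) : setI_closed (sigma_gen f).
Proof. exact: sigma_algebra_setI (smallest_sigma_algebra _ _). Qed.

(** These intersections are stable under intersection and generate the joint sigma-algebra of the
    two gains. *)
Let SA : set (set T) := [set A `&` B | A in sigma_a & B in sigma_b].
Let SB : set (set T) := sigma_z.

Let mSB : SB `<=` measurable.
Proof. by apply: sigma_gen_measurable; case: hz. Qed.

Let mSA : SA `<=` measurable.
Proof.
move=> _ [A hA [B hB <-]]; apply: measurableI.
  by apply: sigma_gen_measurable hA; case: ha_CN.
by apply: sigma_gen_measurable hB; case: hb_CN.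
Qed.

Let SAT : SA setT.
Proof.
exists setT; first exact: sigma_genT.
by exists setT; [exact: sigma_genT|rewrite setIT].
Qed.

Let SBT : SB setT.
Proof. exact: sigma_genT. Qed.

Let SBI : setI_closed SB.
Proof. exact: sigmaI. Qed.

Let SAI : setI_closed SA.
Proof.
move=> _ _ [A hA [B hB <-]] [A' hA' [B' hB' <-]].
exists (A `&` A'); first exact: sigmaI.
by exists (B `&` B'); [exact: sigmaI|rewrite setIACA].
Qed.

Let SAB A B : SA A -> SB B -> P (A `&` B) = (P A * P B)%E.
Proof.
move=> [A1 h1 [A2 h2 <-]] hB; rewrite indep //.
by rewrite -[in RHS](setIT (A1 `&` A2)) indep // probability_setT mule1.
Qed.

(** [T * T] with only the sigma-algebra that decoupling accepts; sums and products of real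
    coordinates can then be treated as measurable functions on it. *)
Let TT := g_sigma_algebraType (rectangles SA SB).

Let measurable_a p : measurable_fun [set: TT]
  ((fun q => reim (fun _ : unit => ha) p q.1) : TT -> R).
Proof.
move=> _ B mB; rewrite setTI; apply: sub_sigma_algebra.
exists (reim (fun _ : unit => ha) p @^-1` B).
  exists (reim (fun _ : unit => ha) p @^-1` B).
    by apply: sub_sigma_algebra; exists p, B.
  by exists setT; [exact: sigma_genT|rewrite setIT].
exists setT; first exact: sigma_genT.
by apply/seteqP; split => -[w w'] //= [].
Qed.

Let measurable_b p : measurable_fun [set: TT]
  ((fun q => reim (fun _ : unit => hb) p q.1) : TT -> R).
Proof.
move=> _ B mB; rewrite setTI; apply: sub_sigma_algebra.
exists (reim (fun _ : unit => hb) p @^-1` B).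
  exists setT; first exact: sigma_genT.
  exists (reim (fun _ : unit => hb) p @^-1` B); last by rewrite setTI.
  by apply: sub_sigma_algebra; exists p, B.
exists setT; first exact: sigma_genT.
by apply/seteqP; split => -[w w'] //= [].
Qed.

Let measurable_z p : measurable_fun [set: TT]
  ((fun q => reim (fun (k : 'I_N) w => z w k 0) p q.2) : TT -> R).
Proof.
move=> _ B mB; rewrite setTI; apply: sub_sigma_algebra.
exists setT; first exact: SAT.
exists (reim (fun (k : 'I_N) w => z w k 0) p @^-1` B).
  by apply: sub_sigma_algebra; exists p, B.
by apply/seteqP; split => -[w w'] //= [].
Qed.

Let obs_event (xa xb : 'cV[R[i]]_N) (W : set (observation R N)) : set (T * T) :=
  [set q | W (receiver_obs (ha q.1) (hb q.1) xa xb (z q.2))].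

Let obs_event_measurable xa xb W : sigma_gen (@obs_coord R N) W ->
  <<s rectangles SA SB >> (obs_event xa xb W).
Proof.
move=> hW; apply: (smallest_preimage (S := <<s rectangles SA SB >>)
  (f := fun q : T * T => receiver_obs (ha q.1) (hb q.1) xa xb (z q.2))) hW => //.
move=> _ [p [B [mB ->]]].
suff : measurable_fun [set: TT] ((fun q => reim (@obs_coord R N) p
    (receiver_obs (ha q.1) (hb q.1) xa xb (z q.2))) : TT -> R).
  by move=> /(_ measurableT _ mB); rewrite setTI.
have ma c := measurable_a (tt, c); have mb c := measurable_b (tt, c).
have mz k c := measurable_z (k, c).
case: p => -[k|j] c; rewrite /reim /obs_coord /=.
  have -> : (fun q : TT => if c
      then complex.Im ((ha q.1 *: xa + hb q.1 *: xb + z q.2) k 0)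
      else complex.Re ((ha q.1 *: xa + hb q.1 *: xb + z q.2) k 0)) =
    (fun q : TT => if c then
      complex.Re (ha q.1) * complex.Im (xa k 0)
      + complex.Im (ha q.1) * complex.Re (xa k 0)
      + (complex.Re (hb q.1) * complex.Im (xb k 0)
         + complex.Im (hb q.1) * complex.Re (xb k 0))
      + complex.Im (z q.2 k 0)
    else
      complex.Re (ha q.1) * complex.Re (xa k 0)
      - complex.Im (ha q.1) * complex.Im (xa k 0)
      + (complex.Re (hb q.1) * complex.Re (xb k 0)
         - complex.Im (hb q.1) * complex.Im (xb k 0))
      + complex.Re (z q.2 k 0)).
    apply/funext => q; rewrite !mxE.
    by case: c; case: (ha q.1) (hb q.1) (z q.2 k 0) (xa k 0) (xb k 0)
      => [? ?] [? ?] [? ?] [? ?] [? ?].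
  case: c; apply: measurable_funD;
    first [exact: (mz k true) | exact: (mz k false) | idtac].
  - apply: measurable_funD; apply: measurable_funD; apply: measurable_funM => //;
      by [exact: (ma false)|exact: (ma true)|exact: (mb false)|exact: (mb true)].
  - apply: measurable_funD; apply: measurable_funB; apply: measurable_funM => //;
      by [exact: (ma false)|exact: (ma true)|exact: (mb false)|exact: (mb true)].
have -> : (fun q : TT => if c
    then complex.Im (hvec (ha q.1) (hb q.1) j 0)
    else complex.Re (hvec (ha q.1) (hb q.1) j 0)) =
  (fun q => if j == 0 then reim (fun _ : unit => ha) (tt, c) q.1
     else reim (fun _ : unit => hb) (tt, c) q.1).
  by apply/funext => q; rewrite mxE; case: (j == 0).
by case: (j == 0).
Qed.

Let section_pr xa xb W w :=
  pr P [set w' | W (receiver_obs (ha w) (hb w) xa xb (z w'))].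

Let obs_section xa xb W w :
  [set w' | W (receiver_obs (ha w) (hb w) xa xb (z w'))] =
  xsection (obs_event xa xb W) w.
Proof. by apply/seteqP; split => w' /=; rewrite /xsection /= inE. Qed.

Let measurable_section xa xb W w : sigma_gen (@obs_coord R N) W ->
  measurable [set w' | W (receiver_obs (ha w) (hb w) xa xb (z w'))].
Proof.
move=> hW; rewrite obs_section; apply: measurable_xsection.
by apply: (rectangles_measurable mSA mSB); exact: obs_event_measurable.
Qed.

Let measurable_section_pr xa xb W : sigma_gen (@obs_coord R N) W ->
  measurable_fun setT (fun w => (section_pr xa xb W w)%:E).
Proof.
move=> hW; have -> : (fun w => (section_pr xa xb W w)%:E) =
    P \o xsection (obs_event xa xb W).
  apply/funext => w; rewrite prE; last exact: measurable_section.
  by rewrite obs_section.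
apply: measurable_fun_xsection.
by apply: (rectangles_measurable mSA mSB); exact: obs_event_measurable.
Qed.

Let measurable_obs xa xb W : sigma_gen (@obs_coord R N) W ->
  measurable [set w | W (receiver_obs (ha w) (hb w) xa xb (z w))].
Proof.
move=> /(obs_event_measurable xa xb)/(rectangles_measurable mSA mSB) mW.
have mdiag : measurable_fun [set: T] (fun w : T => (w, w)).
  exact: measurable_fun_pair.
by have := mdiag measurableT _ mW; rewrite setTI.
Qed.

(** Decoupling writes the total error as an integral, over the gains, of the error with frozen
    gains. Were the latter above [e] throughout [H], the integral would be at least [e * pr P H]. *)
Lemma exists_fading (J : finType) (xa xb : J -> 'cV[R[i]]_N)
    (W : J -> set (observation R N)) (H : set T) (e : R) :
  (forall j, sigma_gen (@obs_coord R N) (W j)) -> measurable H -> 0 <= e ->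
  \sum_j pr P [set w | W j (receiver_obs (ha w) (hb w) (xa j) (xb j) (z w))] <
    e * pr P H ->
  exists2 w, H w & \sum_j
    pr P [set w' | W j (receiver_obs (ha w) (hb w) (xa j) (xb j) (z w'))] <= e.
Proof.
move=> mW mH e0; apply: contraPP => nH.
have {}nH w : H w -> e <= \sum_j section_pr (xa j) (xb j) (W j) w.
  by move=> Hw; rewrite leNgt; apply/negP => /ltW he; apply: nH; exists w.
apply/negP; rewrite -leNgt -lee_fin EFinM prE // -sumEFin.
rewrite (eq_bigr (fun j => \int[P]_w (section_pr (xa j) (xb j) (W j) w)%:E)%E);
    last first.
  move=> j _; rewrite prE; last exact: measurable_obs.
  rewrite (decoupling mSA mSB SAT SBT SAI SBI SAB
    (obs_event_measurable (xa j) (xb j) (mW j))).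
  by apply: eq_integral => w _; rewrite prE //; exact: measurable_section.
rewrite -ge0_integral_sum //; last first.
- by move=> j w _; rewrite lee_fin pr_ge0.
- by move=> j; exact: measurable_section_pr.
have mS : measurable_fun setT
    (fun w => (\sum_j (section_pr (xa j) (xb j) (W j) w)%:E)%E).
  by apply: emeasurable_sum => j; exact: measurable_section_pr.
have S0 w : (0 <= \sum_j (section_pr (xa j) (xb j) (W j) w)%:E)%E.
  by apply: sume_ge0 => j _; rewrite lee_fin pr_ge0.
apply: (@le_trans _ _
  (\int[P]_(w in H) (\sum_j (section_pr (xa j) (xb j) (W j) w)%:E))%E).
  rewrite -integral_cst //; apply: ge0_le_integral => //.
    by move: mS; apply: measurable_funS.
  by move=> w Hw; rewrite sumEFin lee_fin; exact: nH.
by apply: ge0_subset_integral.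
Qed.

Lemma section_vec_measurable (W : set (observation R N)) (a b : R[i]) :
  sigma_gen (@obs_coord R N) W -> vec_measurable [set y | W (y, hvec a b)].
Proof.
move=> hW; apply: (smallest_preimage (S := @vec_measurable R N)
  (f := fun y => (y, hvec a b) : observation R N)) hW.
  exact: smallest_sigma_algebra.
move=> _ [[[k|j] c] [B [mB ->]]].
  by apply: sub_sigma_algebra; exists (k, c), B.
(* The gain coordinates are constant on the section, so this preimage is everything or empty. *)
have [h|h] := pselect (B (reim (@obs_coord R N) (inr j, c) (0, hvec a b))).
  by rewrite (_ : _ @^-1` _ = setT); [exact: sigma_genT|apply/seteqP; split].
by rewrite (_ : _ @^-1` _ = set0); [exact: sigma_algebra0|apply/seteqP; split].
Qed.

End receiver.

(** * Probabilities of rectangles of fading gains *)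

Section fading_rectangle.
Context (R : realType) (d : measure_display) (T : measurableType d).
Variables (P : probability T R).

(** Rectangles rather than discs: the real and imaginary parts are independent, so the probability
    factors. *)
Definition in_rectangle (h : T -> R[i]) (a b a' b' : R) : set T :=
  [set w | a <= complex.Re (h w) <= b /\ a' <= complex.Im (h w) <= b'].

Lemma in_rectangle_sigma h a b a' b' :
  sigma_gen (fun _ : unit => h) (in_rectangle h a b a' b').
Proof.
have -> : in_rectangle h a b a' b' =
    reim (fun _ : unit => h) (tt, false) @^-1` `[a, b]%classic `&`
    reim (fun _ : unit => h) (tt, true) @^-1` `[a', b']%classic.
  by apply/seteqP; split => w; rewrite /in_rectangle /reim /= !in_itv.
apply: (sigma_algebra_setI (smallest_sigma_algebra _ _)); apply: sub_sigma_algebra;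
  by eexists; eexists; split; [|reflexivity]; exact: measurable_itv.
Qed.

Lemma pr_in_rectangle (c : R) : 0 < c ->
  (forall a b : R, - 1 <= a -> a <= b -> b <= 1 ->
    ((c * (b - a))%:E <= normal_prob 0 (Num.sqrt 2^-1) `[a, b])%E) ->
  forall h a b a' b', std_CN P (fun _ : unit => h) ->
  - 1 <= a -> a <= b -> b <= 1 -> - 1 <= a' -> a' <= b' -> b' <= 1 ->
  c ^+ 2 * (b - a) * (b' - a') <= pr P (in_rectangle h a b a' b').
Proof.
move=> c0 H h a b a' b' [mh lh ih] h1 h2 h3 h4 h5 h6.
have mrect : measurable (in_rectangle h a b a' b').
  by apply: (sigma_gen_measurable mh); exact: in_rectangle_sigma.
rewrite -lee_fin prE //.
pose B (p : unit * bool) : set R := if p.2 then `[a', b']%classic else `[a, b]%classic.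
have mB p : measurable (B p) by rewrite /B; case: p.2; exact: measurable_itv.
have -> : in_rectangle h a b a' b' =
    \bigcap_p (reim (fun _ : unit => h) p @^-1` B p).
  apply/seteqP; split => w.
    by move=> [hr hi] [[] []] _; rewrite /B /reim /= in_itv.
  move=> hw; have := hw (tt, false) Logic.I; have := hw (tt, true) Logic.I.
  by rewrite /B /reim /= !in_itv.
rewrite (indep_bigcap ih mB).
rewrite -(pair_bigA _
  (fun i j => P (reim (fun _ : unit => h) (i, j) @^-1` B (i, j)))) /=.
rewrite (eq_bigl (pred1 tt)) ?big_pred1_eq; last by case.
rewrite big_bool /= !lh //; try exact: mB.
have -> : c ^+ 2 * (b - a) * (b' - a') = (c * (b' - a')) * (c * (b - a)) by ring.
rewrite EFinM; apply: lee_pmul; rewrite ?lee_fin ?mulr_ge0 ?(ltW c0) ?subr_ge0 //.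
  exact: H.
exact: H.
Qed.

End fading_rectangle.

(** * The two receivers of the Rayleigh channel *)

Section channel.
Context (R : realType) (d : measure_display) (T : measurableType d).
Variables (P : probability T R) (N : nat) (ch : channel R T N).
Hypothesis hch : rayleigh P ch.
Local Notation sigma_h h := (sigma_gen (fun _ : unit => h)).
Local Notation sigma_z z := (sigma_gen (fun (k : 'I_N) w => z w k 0)).

Let both_noises (k : 'I_N + 'I_N) (w : T) : R[i] :=
  match k with inl k1 => z1 ch w k1 0 | inr k2 => z2 ch w k2 0 end.

Let indep5 (A : seq (set T)) :
  sigma_h (h11 ch) (nth set0 A 0) -> sigma_h (h12 ch) (nth set0 A 1) ->
  sigma_h (h21 ch) (nth set0 A 2) -> sigma_h (h22 ch) (nth set0 A 3) ->
  sigma_gen both_noises (nth set0 A 4) ->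
  P (nth set0 A 0 `&` nth set0 A 1 `&` nth set0 A 2 `&` nth set0 A 3 `&` nth set0 A 4)
  = (P (nth set0 A 0) * P (nth set0 A 1) * P (nth set0 A 2) * P (nth set0 A 3)
     * P (nth set0 A 4))%E.
Proof.
case: hch => _ _ _ _ ind a0 a1 a2 a3 a4.
have := ind (finset.setTfor 'I_5) (fun b : 'I_5 => nth set0 A b).
have -> : \bigcap_(i in [set i | i \in finset.setTfor 'I_5]) nth set0 A i =
    nth set0 A 0 `&` nth set0 A 1 `&` nth set0 A 2 `&` nth set0 A 3 `&` nth set0 A 4.
  apply/seteqP; split => w /=.
    move=> h; have hi (i : 'I_5) : nth set0 A i w.
      by apply: h; rewrite /= finset.in_setT.
    by split; [split; [split; [split|]|]|];
      [exact: (hi (@Ordinal 5 0 isT))|exact: (hi (@Ordinal 5 1 isT))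
      |exact: (hi (@Ordinal 5 2 isT))|exact: (hi (@Ordinal 5 3 isT))
      |exact: (hi (@Ordinal 5 4 isT))].
  by move=> [[[[b0 b1] b2] b3] b4] [[|[|[|[|[|//]]]]] ?] _.
move=> ->; last by move=> [[|[|[|[|[|//]]]]] ?] _.
rewrite (eq_bigl xpredT) => [|i]; last by rewrite finset.in_setT.
by rewrite !big_ord_recl big_ord0 mule1 /= !muleA.
Qed.

(** The slots of the other two gains are filled with [setT], and an event of [z1] is an event of the
    pair of noises. *)
Lemma rayleigh_indep1 A B C : sigma_h (h11 ch) A -> sigma_h (h21 ch) B ->
  sigma_z (z1 ch) C -> P (A `&` B `&` C) = (P A * P B * P C)%E.
Proof.
move=> hA hB hC.
have := @indep5 [:: A; setT; B; setT; C] hA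
  (@sigma_genT _ _ unit (fun _ => h12 ch)) hB
  (@sigma_genT _ _ unit (fun _ => h22 ch)) _.
rewrite /= !setIT probability_setT !mule1; apply.
suff : sigma_z (z1 ch) `<=` sigma_gen both_noises by move=> /(_ _ hC).
apply: sub_sigma_algebra2 => _ [[k b] [E [mE ->]]].
by exists (inl k, b), E.
Qed.

Lemma rayleigh_indep2 A B C : sigma_h (h12 ch) A -> sigma_h (h22 ch) B ->
  sigma_z (z2 ch) C -> P (A `&` B `&` C) = (P A * P B * P C)%E.
Proof.
move=> hA hB hC.
have := @indep5 [:: setT; A; setT; B; C] 
  (@sigma_genT _ _ unit (fun _ => h11 ch)) hA
  (@sigma_genT _ _ unit (fun _ => h21 ch)) hB _.
rewrite /= !setIT !setTI probability_setT !mule1 !mul1e; apply.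
suff : sigma_z (z2 ch) `<=` sigma_gen both_noises by move=> /(_ _ hC).
apply: sub_sigma_algebra2 => _ [[k b] [E [mE ->]]].
by exists (inr k, b), E.
Qed.

Lemma obs1E snr alpha x1 x2 w :
  obs1 ch snr alpha x1 x2 w =
  receiver_obs (h11 ch w) (h21 ch w) ((Num.sqrt snr)%:C%C *: x1)
    ((Num.sqrt (snr `^ alpha))%:C%C *: x2) (z1 ch w).
Proof.
by rewrite /obs1 /received /receiver_obs !scalerA ![_ * (_)%:C%C]mulrC.
Qed.

Lemma obs2E snr alpha x1 x2 w :
  obs2 ch snr alpha x1 x2 w =
  receiver_obs (h12 ch w) (h22 ch w) ((Num.sqrt (snr `^ alpha))%:C%C *: x1)
    ((Num.sqrt snr)%:C%C *: x2) (z2 ch w).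
Proof.
rewrite /obs2 /received /receiver_obs !scalerA ![_ * (_)%:C%C]mulrC.
by congr ((_ + _), _); rewrite addrC.
Qed.

Let decoder_error M (dec : observation R N -> 'I_M) m : decoder_ok dec ->
  sigma_gen (@obs_coord R N) [set o | dec o <> m].
Proof.
move=> hd; have -> : [set o | dec o <> m] = setT `\` [set o | dec o = m].
  by rewrite setTD.
exact: sigma_algebraCD (hd m).
Qed.

Variables (snr alpha eps : R) (c : block_code R N).
Hypotheses (md1 : decoder_ok (dec1 c)) (md2 : decoder_ok (dec2 c)).
Hypotheses (M1_gt0 : (0 < size1 c)%N) (M2_gt0 : (0 < size2 c)%N).

Let M_gt0 : 0 < (size1 c * size2 c)%:R :> R.
Proof. by rewrite ltr0n muln_gt0 M1_gt0. Qed.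

(** Probability at least [8 * eps] for [H] brings the average error [eps] down to 1/8 at some
    realisation in [H]. *)
Lemma exists_fading1 (H : set T) : perr1 P ch snr alpha c < eps ->
  measurable H -> 8 * eps <= pr P H ->
  exists2 w, H w & \sum_m1 \sum_m2
    pr P [set w' | dec1 c (receiver_obs (h11 ch w) (h21 ch w)
      ((Num.sqrt snr)%:C%C *: enc1 c m1)
      ((Num.sqrt (snr `^ alpha))%:C%C *: enc2 c m2) (z1 ch w')) <> m1] <=
    (size1 c * size2 c)%:R / 8.
Proof.
move=> hp mH hH; case: (hch) => -[c11 c12] [c21 c22] cz1 cz2 _.
pose xa (p : 'I_(size1 c) * 'I_(size2 c)) := (Num.sqrt snr)%:C%C *: enc1 c p.1.
pose xb (p : 'I_(size1 c) * 'I_(size2 c)) :=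
  (Num.sqrt (snr `^ alpha))%:C%C *: enc2 c p.2.
pose f ha hb z i j := pr P [set w : T | dec1 c (receiver_obs (ha w) (hb w)
  ((Num.sqrt snr)%:C%C *: enc1 c i)
  ((Num.sqrt (snr `^ alpha))%:C%C *: enc2 c j) (z w)) <> i].
have hsum : \sum_(p : 'I_(size1 c) * 'I_(size2 c)) pr P [set w |
    [set o | dec1 c o <> p.1] (receiver_obs (h11 ch w) (h21 ch w) (xa p) (xb p)
      (z1 ch w))] < (size1 c * size2 c)%:R / 8 * pr P H.
  rewrite -(pair_bigA _ (f (h11 ch) (h21 ch) (z1 ch))) /=.
  have : perr1 P ch snr alpha c = (size1 c * size2 c)%:R^-1 *
      \sum_i \sum_j f (h11 ch) (h21 ch) (z1 ch) i j.
    rewrite /perr1; congr (_ * _); apply: eq_bigr => i _; apply: eq_bigr => j _.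
    by congr (fine (P _)); apply/funext => w; rewrite /mkset obs1E.
  move=> hE; move: hp; rewrite hE mulrC ltr_pdivrMr //.
  move/lt_le_trans; apply; rewrite mulrAC [leLHS]mulrC -mulrA ler_pM2l //.
  by rewrite ler_pdivlMr // mulrC.
have [w Hw hw] := exists_fading c11 c21 cz1 rayleigh_indep1
  (fun p => decoder_error p.1 md1) mH (divr_ge0 (ltW M_gt0) (ler0n _ _)) hsum.
exists w => //; move: hw.
by rewrite -(pair_bigA _ (f (fun=> h11 ch w) (fun=> h21 ch w) (z1 ch))).
Qed.

Lemma exists_fading2 (H : set T) : perr2 P ch snr alpha c < eps ->
  measurable H -> 8 * eps <= pr P H ->
  exists2 w, H w & \sum_m1 \sum_m2
    pr P [set w' | dec2 c (receiver_obs (h12 ch w) (h22 ch w)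
      ((Num.sqrt (snr `^ alpha))%:C%C *: enc1 c m1)
      ((Num.sqrt snr)%:C%C *: enc2 c m2) (z2 ch w')) <> m2] <=
    (size1 c * size2 c)%:R / 8.
Proof.
move=> hp mH hH; case: (hch) => -[c11 c12] [c21 c22] cz1 cz2 _.
pose xa (p : 'I_(size1 c) * 'I_(size2 c)) :=
  (Num.sqrt (snr `^ alpha))%:C%C *: enc1 c p.1.
pose xb (p : 'I_(size1 c) * 'I_(size2 c)) := (Num.sqrt snr)%:C%C *: enc2 c p.2.
pose f ha hb z i j := pr P [set w : T | dec2 c (receiver_obs (ha w) (hb w)
  ((Num.sqrt (snr `^ alpha))%:C%C *: enc1 c i)
  ((Num.sqrt snr)%:C%C *: enc2 c j) (z w)) <> j].
have hsum : \sum_(p : 'I_(size1 c) * 'I_(size2 c)) pr P [set w |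
    [set o | dec2 c o <> p.2] (receiver_obs (h12 ch w) (h22 ch w) (xa p) (xb p)
      (z2 ch w))] < (size1 c * size2 c)%:R / 8 * pr P H.
  rewrite -(pair_bigA _ (f (h12 ch) (h22 ch) (z2 ch))) /=.
  have : perr2 P ch snr alpha c = (size1 c * size2 c)%:R^-1 *
      \sum_i \sum_j f (h12 ch) (h22 ch) (z2 ch) i j.
    rewrite /perr2; congr (_ * _); apply: eq_bigr => i _; apply: eq_bigr => j _.
    by congr (fine (P _)); apply/funext => w; rewrite /mkset obs2E.
  move=> hE; move: hp; rewrite hE mulrC ltr_pdivrMr //.
  move/lt_le_trans; apply; rewrite mulrAC [leLHS]mulrC -mulrA ler_pM2l //.
  by rewrite ler_pdivlMr // mulrC.
have [w Hw hw] := exists_fading c12 c22 cz2 rayleigh_indep2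
  (fun p => decoder_error p.2 md2) mH (divr_ge0 (ltW M_gt0) (ler0n _ _)) hsum.
exists w => //; move: hw.
by rewrite -(pair_bigA _ (f (fun=> h12 ch w) (fun=> h22 ch w) (z2 ch))).
Qed.

End channel.

(** * Bounds for one code *)

(** For each [i] the codewords are packed around their own centre [o i]. Averaging over [i] leaves
    7/8 of [M] below the shift cost, and 8/7 <= 2. *)
Lemma single_user_average (R : realType) (d : measure_display)
    (T : measurableType d) (P : probability T R) (N : nat)
    (z : T -> 'cV[R[i]]_N) (hz : std_CN P (fun (k : 'I_N) w => z w k 0))
    (M' M : nat) (D : 'cV[R[i]]_N -> 'I_M)
    (v : 'I_M' -> 'I_M -> 'cV[R[i]]_N) (o : 'I_M' -> 'cV[R[i]]_N) (sigma : R) :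
  (forall m, vec_measurable [set y | D y = m]) ->
  1 <= sigma -> 2 <= sigma ^+ 2 -> (0 < M')%N ->
  (forall i j k, normc (v i j k 0 - o i k 0) <= sigma) ->
  \sum_i \sum_j pr P [set w | D (z w + v i j) <> j] <= (M' * M)%:R / 8 ->
  M%:R <= 2 * shift_cost N sigma.
Proof.
move=> mD s1 s2 M0 vs he.
have key : \sum_(i < M') (M%:R - \sum_j pr P [set w | D (z w + v i j) <> j]) <=
    \sum_(i < M') shift_cost N sigma.
  by apply: ler_sum => i _; exact: (single_user_bound hz mD s1 s2 (vs i)).
move: key; rewrite sumrB !sumr_const card_ord.
rewrite -[M%:R *+ M']mulr_natl -[shift_cost _ _ *+ M']mulr_natl => key.
have c0 : 0 <= shift_cost N sigma by rewrite shift_cost_ge0 // (le_trans _ s1).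
have M'0 : 0 < M'%:R :> R by rewrite ltr0n.
rewrite -(ler_pM2l M'0) mulrCA; move: he key; rewrite natrM.
have : 0 <= M'%:R * shift_cost N sigma by rewrite mulr_ge0 // ltW.
move: (M'%:R * shift_cost N sigma) (\sum_i _) (M'%:R * M%:R) => k s m.
by lra.
Qed.

Lemma power_ok_normc (R : realType) (N : nat) (x : 'cV[R[i]]_N) k :
  power_ok x -> normc (x k 0) <= Num.sqrt N%:R.
Proof.
move=> hx; have E (a : R[i]) : (`|a| ^+ 2 = ((normc a) ^+ 2)%:C)%C.
  by case: a => u v; rewrite normc_def /= -rmorphXn.
have : \sum_(i < N) normc (x i 0) ^+ 2 <= N%:R.
  rewrite -lecR rmorph_nat rmorph_sum /=; apply: le_trans hx; rewrite le_eqVlt.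
  by apply/orP; left; apply/eqP; apply: eq_bigr => i _; exact: esym (E (x i 0)).
rewrite (bigD1 k) //= => h.
have h2 : normc (x k 0) ^+ 2 <= N%:R.
  by apply: le_trans h; rewrite lerDl sumr_ge0 // => i _; exact: sqr_ge0.
by rewrite -(ger0_norm (normc_ge0 (x k 0))) -sqrtr_sqr; apply: ler_wsqrtr.
Qed.

Lemma normc_real (R : realType) (t : R) : 0 <= t -> normc (t%:C%C) = t.
Proof. by move=> t0; rewrite /= expr0n addr0 sqrtr_sqr ger0_norm. Qed.

Lemma normc_scale (R : realType) (h x : R[i]) (t : R) : 0 <= t ->
  normc (h * (t%:C%C * x)) = normc h * (t * normc x).
Proof. by move=> t0; rewrite !ComplexField.Normc.normcM (normc_real t0). Qed.

Lemma scale2_coord (R : realType) N (a s : R[i]) (x : 'cV[R[i]]_N) k :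
  (a *: (s *: x)) k 0 = a * (s * x k 0).
Proof. by rewrite !mxE. Qed.

Lemma mix_coord (R : realType) N (a b s t : R[i]) (x y : 'cV[R[i]]_N) k :
  (a *: (s *: x) + b *: (t *: y)) k 0 = a * (s * x k 0) + b * (t * y k 0).
Proof. by rewrite !mxE. Qed.

Lemma mix_coord_sub (R : realType) N (a b s t : R[i]) (x y y' : 'cV[R[i]]_N) k :
  (a *: (s *: x) + b *: (t *: y)) k 0 - (a *: (s *: x) + b *: (t *: y')) k 0 =
  b * (t * (y k 0 - y' k 0)).
Proof. by rewrite !mix_coord; move: (x k 0) (y k 0) (y' k 0) => p q r; ring. Qed.

Lemma in_rectangle_normc (R : realType) (d : measure_display)
    (T : measurableType d) (h : T -> R[i]) (x : R) w :
  in_rectangle h (- x) x (- x) x w -> normc (h w) <= 2 * x.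
Proof.
by move=> [hr hi]; apply: normc_le_reim => -[]; rewrite ler_norml.
Qed.

Section code_bounds.
Context (R : realType) (d : measure_display) (T : measurableType d).
Variables (P : probability T R) (N : nat) (ch : channel R T N) (alpha : R).
Hypothesis hch : rayleigh P ch.
Variables (c0 rho : R).
Hypotheses (c0_gt0 : 0 < c0) (rho_gt0 : 0 < rho).
Hypothesis normal_lb : forall a b : R, - 1 <= a -> a <= b -> b <= 1 ->
  ((c0 * (b - a))%:E <= normal_prob 0 (Num.sqrt 2^-1) `[a, b])%E.
Hypothesis z1_tight : pr P (~` [set w | vec_box rho 0 (z1 ch w)]) <= 8^-1.

Let nu : R := Num.sqrt N%:R.
Let nu_ge0 : 0 <= nu. Proof. exact: sqrtr_ge0. Qed.

(** [nu] bounds a codeword coordinate and a gain modulus is at most twice its scale, so two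
    superposed signals give 4 [nu]; the summand 2 secures the lower bounds required of [sigma]. *)
Let K1 : R := 4 * nu + 2.
(** Dividing the distance 4 [rho] by at least half the scale of [h21] gives 8 [rho]; multiplying by
    [h22] doubles it. *)
Let K2 : R := 16 * rho + 2.

Let K1_ge2 : 2 <= K1.
Proof. by move: nu_ge0; rewrite /K1; lra. Qed.
Let K2_ge2 : 2 <= K2.
Proof. by move: rho_gt0; rewrite /K2; lra. Qed.

Variables (snr : R) (c : block_code R N) (eps : R).
Hypothesis snr_gt1 : 1 < snr.
Hypotheses (md1 : decoder_ok (dec1 c)) (md2 : decoder_ok (dec2 c)).
Hypotheses (M1_gt0 : (0 < size1 c)%N) (M2_gt0 : (0 < size2 c)%N).
Hypothesis pow1 : forall m, power_ok (enc1 c m).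
Hypothesis pow2 : forall m, power_ok (enc2 c m).

Let snr_gt0 : 0 < snr. Proof. exact: lt_trans snr_gt1. Qed.
Let pw (t : R) : R := snr `^ t.
Let pw_gt0 t : 0 < pw t. Proof. exact: powR_gt0. Qed.
Let pwD s t : pw (s + t) = pw s * pw t.
Proof. by rewrite /pw powRD // (gt_eqF snr_gt0) implybT. Qed.
Let pw0 : pw 0 = 1. Proof. exact: powRr0. Qed.
Let le_pw s t : s <= t -> pw s <= pw t.
Proof. by move=> st; rewrite ler_powR // ltW. Qed.
Let pw_ge1 t : 0 <= t -> 1 <= pw t.
Proof. by move=> t0; rewrite -[leLHS]pw0; exact: le_pw. Qed.
Let pw_le1 t : t <= 0 -> pw t <= 1.
Proof. by move=> t0; rewrite -[leRHS]pw0; exact: le_pw. Qed.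
Let pw_half t : Num.sqrt (pw t) = pw (t / 2).
Proof.
by rewrite -powR12_sqrt ?(ltW (pw_gt0 _)) // /pw -powRrM.
Qed.
Let sqrt_snr : Num.sqrt snr = pw (1 / 2).
Proof. by rewrite -pw_half /pw powRr1 // ltW. Qed.

Let sigma_ok K p : 2 <= K -> 0 <= p ->
  1 <= K * pw (p / 2) /\ 2 <= (K * pw (p / 2)) ^+ 2.
Proof.
move=> hK p0; have h : 1 <= pw (p / 2) by rewrite pw_ge1 // divr_ge0.
have h2 : 2 <= K * pw (p / 2) by rewrite -[leLHS]mulr1; apply: ler_pM.
by split; [lra|rewrite expr2 -[leLHS]mulr1; apply: ler_pM => //; lra].
Qed.

Let shift_cost_pw K p : 0 <= K ->
  shift_cost N (K * pw (p / 2)) = (K * expR 2) ^+ (N * 2) * pw (N%:R * p).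
Proof.
move=> hK; rewrite /shift_cost mulrAC exprMn; congr (_ * _).
rewrite -powR_mulrn ?(ltW (pw_gt0 _)) // /pw -powRrM; congr (_ `^ _).
by rewrite natrM; field.
Qed.

Let rect_small (h : T -> R[i]) t : std_CN P (fun _ : unit => h) -> 0 <= t ->
  4 * c0 ^+ 2 * pw (- t) <=
  pr P (in_rectangle h (- pw (- t / 2)) (pw (- t / 2)) (- pw (- t / 2)) (pw (- t / 2))).
Proof.
move=> hh t0; have x0 := pw_gt0 (- t / 2).
have x1 : pw (- t / 2) <= 1 by rewrite pw_le1 // mulNr oppr_le0 divr_ge0.
apply: le_trans (pr_in_rectangle c0_gt0 normal_lb hh _ _ _ _ _ _); try lra.
have -> : pw (- t) = pw (- t / 2) * pw (- t / 2) by rewrite -pwD -splitr.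
by rewrite le_eqVlt; apply/orP; left; apply/eqP; ring.
Qed.

(** Keeping the real part above half the scale also bounds the modulus from below, at the cost of a
    constant factor in probability. *)
Let rect_annulus (h : T -> R[i]) t : std_CN P (fun _ : unit => h) -> 0 <= t ->
  c0 ^+ 2 * pw (- t) <=
  pr P (in_rectangle h (pw (- t / 2) / 2) (pw (- t / 2))
    (- pw (- t / 2)) (pw (- t / 2))).
Proof.
move=> hh t0; have x0 := pw_gt0 (- t / 2).
have x1 : pw (- t / 2) <= 1 by rewrite pw_le1 // mulNr oppr_le0 divr_ge0.
apply: le_trans (pr_in_rectangle c0_gt0 normal_lb hh _ _ _ _ _ _); try lra.
have -> : pw (- t) = pw (- t / 2) * pw (- t / 2) by rewrite -pwD -splitr.
by rewrite le_eqVlt; apply/orP; left; apply/eqP; field.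
Qed.

Let mrect h a b a' b' : std_CN P (fun _ : unit => h) ->
  measurable (in_rectangle h a b a' b' : set T).
Proof.
by move=> [mh _ _]; apply: (sigma_gen_measurable mh); exact: in_rectangle_sigma.
Qed.

(** A fade of |h11|^2 to SNR^(-(1 - u)) shrinks the direct signal to amplitude SNR^(u/2), while the
    interference only moves the centre of the packing. *)
Lemma code_bound1 u : perr1 P ch snr alpha c < eps -> 0 <= u <= 1 ->
  8 * eps <= 4 * c0 ^+ 2 * pw (- (1 - u)) ->
  (size1 c)%:R <= 2 * (K1 * expR 2) ^+ (N * 2) * pw (N%:R * u).
Proof.
move=> hp /andP[u0 u1] he; case: (hch) => -[c11 c12] [c21 c22] cz1 cz2 _.
have t0 : 0 <= 1 - u by rewrite subr_ge0.
have [w Hw] := exists_fading1 hch md1 M1_gt0 M2_gt0 hp (mrect _ _ _ _ c11)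
  (le_trans he (rect_small c11 t0)).
(* The interfering message becomes the outer index, because each of its values has its own
   centre. *)
rewrite exchange_big /= mulnC => hw.
have hK := K1_ge2.
have [s1 s2] := sigma_ok hK u0.
rewrite -mulrA -shift_cost_pw; last by rewrite (le_trans _ hK).
apply: (single_user_average (P := P) (z := z1 ch) cz1
  (D := fun y => dec1 c (y, hvec (h11 ch w) (h21 ch w)))
  (v := fun j i => h11 ch w *: ((Num.sqrt snr)%:C%C *: enc1 c i) +
     h21 ch w *: ((Num.sqrt (snr `^ alpha))%:C%C *: enc2 c j))
  (o := fun j => h21 ch w *: ((Num.sqrt (snr `^ alpha))%:C%C *: enc2 c j))
  _ s1 s2 M2_gt0).
- by move=> m; exact: section_vec_measurable (md1 m).
- move=> j i k.
  rewrite mix_coord scale2_coord addrK.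
  rewrite normc_scale; last exact: sqrtr_ge0.
  have hb := in_rectangle_normc Hw; have hx := power_ok_normc k (pow1 i).
  rewrite sqrt_snr.
  apply: (@le_trans _ _ (2 * pw (- (1 - u) / 2) * (pw (1 / 2) * nu))).
    apply: ler_pM => //; [exact: normc_ge0| |].
      by rewrite mulr_ge0 ?normc_ge0 // ltW.
    by rewrite ler_pM2l.
  have -> : u / 2 = - (1 - u) / 2 + 1 / 2 by field.
  rewrite pwD /K1.
  have : 0 < pw (- (1 - u) / 2) * pw (1 / 2) by rewrite mulr_gt0.
  by move: (pw (- (1 - u) / 2)) (pw (1 / 2)) nu_ge0 => x y n0 xy0; nra.
apply: le_trans hw; rewrite le_eqVlt; apply/orP; left; apply/eqP.
apply: eq_bigr => j _; apply: eq_bigr => i _; congr (pr P _).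
by apply/funext => u'; rewrite /mkset /receiver_obs [X in (X, _)]addrC.
Qed.

Lemma code_bound2 u : perr2 P ch snr alpha c < eps -> 0 <= u <= 1 ->
  8 * eps <= 4 * c0 ^+ 2 * pw (- (1 - u)) ->
  (size2 c)%:R <= 2 * (K1 * expR 2) ^+ (N * 2) * pw (N%:R * u).
Proof.
move=> hp /andP[u0 u1] he; case: (hch) => -[c11 c12] [c21 c22] cz1 cz2 _.
have t0 : 0 <= 1 - u by rewrite subr_ge0.
have [w Hw hw] := exists_fading2 hch md2 M1_gt0 M2_gt0 hp (mrect _ _ _ _ c22)
  (le_trans he (rect_small c22 t0)).
have hK := K1_ge2.
have [s1 s2] := sigma_ok hK u0.
rewrite -mulrA -shift_cost_pw; last by rewrite (le_trans _ hK).
apply: (single_user_average (P := P) (z := z2 ch) cz2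
  (D := fun y => dec2 c (y, hvec (h12 ch w) (h22 ch w)))
  (v := fun i j => h12 ch w *: ((Num.sqrt (snr `^ alpha))%:C%C *: enc1 c i) +
     h22 ch w *: ((Num.sqrt snr)%:C%C *: enc2 c j))
  (o := fun i => h12 ch w *: ((Num.sqrt (snr `^ alpha))%:C%C *: enc1 c i))
  _ s1 s2 M1_gt0).
- by move=> m; exact: section_vec_measurable (md2 m).
- move=> i j k.
  rewrite mix_coord scale2_coord addrAC subrr add0r.
  rewrite normc_scale; last exact: sqrtr_ge0.
  have hb := in_rectangle_normc Hw; have hx := power_ok_normc k (pow2 j).
  rewrite sqrt_snr.
  apply: (@le_trans _ _ (2 * pw (- (1 - u) / 2) * (pw (1 / 2) * nu))).
    apply: ler_pM => //; [exact: normc_ge0| |].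
      by rewrite mulr_ge0 ?normc_ge0 // ltW.
    by rewrite ler_pM2l.
  have -> : u / 2 = - (1 - u) / 2 + 1 / 2 by field.
  rewrite pwD /K1.
  have : 0 < pw (- (1 - u) / 2) * pw (1 / 2) by rewrite mulr_gt0.
  by move: (pw (- (1 - u) / 2)) (pw (1 / 2)) nu_ge0 => x y n0 xy0; nra.
apply: le_trans hw; rewrite le_eqVlt; apply/orP; left; apply/eqP.
apply: eq_bigr => i _; apply: eq_bigr => j _; congr (pr P _).
by apply/funext => u'; rewrite /mkset /receiver_obs [X in (X, _)]addrC.
Qed.

(** [p] bounds the exponent of the received signal power at receiver 1, and [q] that of the squared
    radius, at receiver 2, of the list left by receiver 1. *)
Lemma code_bound12 (a b e p q : R) :
  perr1 P ch snr alpha c < eps -> perr2 P ch snr alpha c < eps ->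
  0 <= a -> 0 <= b -> 0 <= e -> 0 <= p -> 0 <= q ->
  1 - b <= p -> alpha - a <= p -> 1 - e - alpha + a <= q ->
  8 * eps <= 4 * c0 ^+ 4 * pw (- (a + b)) -> 8 * eps <= 4 * c0 ^+ 2 * pw (- e) ->
  (size1 c * size2 c)%:R <=
  4 * (K1 * expR 2) ^+ (N * 2) * (K2 * expR 2) ^+ (N * 2) * pw (N%:R * (p + q)).
Proof.
move=> hp1 hp2 a0 b0 e0 p0 q0 bp ap eq he1 he2.
case: (hch) => -[c11 c12] [c21 c22] cz1 cz2 _.
pose H11 := in_rectangle (h11 ch) (- pw (- b / 2)) (pw (- b / 2))
  (- pw (- b / 2)) (pw (- b / 2)).
pose H21 := in_rectangle (h21 ch) (pw (- a / 2) / 2) (pw (- a / 2))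
  (- pw (- a / 2)) (pw (- a / 2)).
have mH11 : measurable H11 := mrect _ _ _ _ c11.
have mH21 : measurable H21 := mrect _ _ _ _ c21.
have prH : pr P (H11 `&` H21) = pr P H11 * pr P H21.
  apply: EFin_inj; rewrite EFinM !prE //; last exact: measurableI.
  rewrite -[H11 `&` H21]setIT (rayleigh_indep1 hch).
  - by rewrite probability_setT mule1.
  - exact: in_rectangle_sigma.
  - exact: in_rectangle_sigma.
  - exact: sigma_genT.
have hH : 8 * eps <= pr P (H11 `&` H21).
  apply: le_trans he1 _; rewrite prH.
  have -> : 4 * c0 ^+ 4 * pw (- (a + b)) =
      (4 * c0 ^+ 2 * pw (- b)) * (c0 ^+ 2 * pw (- a)).
    by rewrite opprD pwD; ring.
  apply: ler_pM; [| |exact: (rect_small c11 b0)|exact: (rect_annulus c21 a0)].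
    by rewrite !mulr_ge0 // ltW.
  by rewrite !mulr_ge0 // ltW.
have [w [Hw11 Hw21] hw] := exists_fading1 hch md1 M1_gt0 M2_gt0 hp1
  (measurableI _ _ mH11 mH21) hH.
(* A second sample point for the same codebooks: receiver 2 is frozen independently of receiver
   1. *)
have [w' Hw' hw'] := exists_fading2 hch md2 M1_gt0 M2_gt0 hp2 (mrect _ _ _ _ c22)
  (le_trans he2 (rect_small c22 e0)).
have b11 := in_rectangle_normc Hw11.
have b22 := in_rectangle_normc Hw'.
have b21 : normc (h21 ch w) <= 2 * pw (- a / 2).
  apply: (in_rectangle_normc (h := h21 ch)); split; last by case: Hw21.
  case: Hw21 => /andP[h1 h2] _; rewrite h2 andbT; apply: le_trans h1.
  by have := pw_gt0 (- a / 2); lra.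
have l21 : pw (- a / 2) / 2 <= normc (h21 ch w).
  case: Hw21 => /andP[h1 _] _; apply: le_trans h1 _.
  by apply: le_trans (ler_norm _) (normc_ge_reim (h21 ch w) false).
have hK1 := K1_ge2; have hK2 := K2_ge2.
have [s11 s12] := sigma_ok hK1 p0.
have [s21 s22] := sigma_ok hK2 q0.
have -> : 4 * (K1 * expR 2) ^+ (N * 2) * (K2 * expR 2) ^+ (N * 2) *
    pw (N%:R * (p + q)) =
    4 * shift_cost N (K1 * pw (p / 2)) * shift_cost N (K2 * pw (q / 2)).
  by rewrite !shift_cost_pw ?(le_trans _ hK1) ?(le_trans _ hK2) // mulrDr pwD; ring.
pose v1 i j := h11 ch w *: ((Num.sqrt snr)%:C%C *: enc1 c i) +
     h21 ch w *: ((Num.sqrt (snr `^ alpha))%:C%C *: enc2 c j).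
pose v2 i j := h12 ch w' *: ((Num.sqrt (snr `^ alpha))%:C%C *: enc1 c i) +
     h22 ch w' *: ((Num.sqrt snr)%:C%C *: enc2 c j).
have sB : Num.sqrt (snr `^ alpha) = pw (alpha / 2) by rewrite pw_half.
apply: (joint_bound (P := P) cz1 cz2 (v1 := v1) (v2 := v2) (rho := rho)
  (D1 := fun y => dec1 c (y, hvec (h11 ch w) (h21 ch w)))
  (D2 := fun y => dec2 c (y, hvec (h12 ch w') (h22 ch w')))
  _ _ s11 s12 s21 s22 _ _ z1_tight).
- by move=> m; exact: section_vec_measurable (md1 m).
- by move=> m; exact: section_vec_measurable (md2 m).
- move=> i j k; rewrite /v1 mix_coord; apply: le_trans (normcD _ _) _.
  rewrite (normc_scale _ _ (sqrtr_ge0 snr)) (normc_scale _ _ (sqrtr_ge0 _)) sqrt_snr sB.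
  have hx1 := power_ok_normc k (pow1 i); have hx2 := power_ok_normc k (pow2 j).
  have q1 : pw (- b / 2) * pw (1 / 2) <= pw (p / 2).
    by rewrite -pwD; apply: le_pw; lra.
  have q2 : pw (- a / 2) * pw (alpha / 2) <= pw (p / 2).
    by rewrite -pwD; apply: le_pw; lra.
  apply: (@le_trans _ _ (2 * pw (- b / 2) * (pw (1 / 2) * nu) +
      2 * pw (- a / 2) * (pw (alpha / 2) * nu))).
    by apply: lerD; apply: ler_pM => //; rewrite ?normc_ge0 ?ler_pM2l //
      mulr_ge0 ?normc_ge0 // ltW.
  have -> : 2 * pw (- b / 2) * (pw (1 / 2) * nu) +
      2 * pw (- a / 2) * (pw (alpha / 2) * nu) =
    2 * nu * (pw (- b / 2) * pw (1 / 2)) + 2 * nu * (pw (- a / 2) * pw (alpha / 2)).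
    by ring.
  have n2 : 0 <= 2 * nu by rewrite mulr_ge0.
  have := ler_wpM2l n2 q1; have := ler_wpM2l n2 q2; have := pw_gt0 (p / 2).
  by rewrite /K1; lra.
- move=> i j j' h k.
  rewrite mix_coord_sub; have := h k; rewrite mix_coord_sub.
  rewrite (normc_scale _ _ (sqrtr_ge0 snr)) (normc_scale _ _ (sqrtr_ge0 _)) sqrt_snr sB.
  set D := normc (_ - _) => hD.
  have D0 : 0 <= D by exact: normc_ge0.
  have hD' : pw (- a / 2) / 2 * (pw (alpha / 2) * D) <= 4 * rho.
    by apply: le_trans hD; apply: ler_wpM2r => //; rewrite mulr_ge0 // ltW.
  (* The lower bound on [h21] turns closeness at receiver 1 into closeness of the second codewords
     themselves. *)
  have {}hD' : D <= 8 * rho * pw ((a - alpha) / 2).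
    have E : pw (- a / 2) * pw (alpha / 2) * pw ((a - alpha) / 2) = 1.
      by rewrite -!pwD -[RHS]pw0; congr pw; field.
    have := ler_wpM2r (ltW (pw_gt0 ((a - alpha) / 2))) hD'.
    have -> : pw (- a / 2) / 2 * (pw (alpha / 2) * D) * pw ((a - alpha) / 2) =
      (pw (- a / 2) * pw (alpha / 2) * pw ((a - alpha) / 2)) * D / 2 by field.
    by rewrite E mul1r; lra.
  apply: (@le_trans _ _ (2 * pw (- e / 2) * (pw (1 / 2) *
      (8 * rho * pw ((a - alpha) / 2))))).
    by apply: ler_pM => //; rewrite ?normc_ge0 ?ler_pM2l // mulr_ge0 // ltW.
  have -> : 2 * pw (- e / 2) * (pw (1 / 2) * (8 * rho * pw ((a - alpha) / 2))) =
    16 * rho * pw (- e / 2 + 1 / 2 + (a - alpha) / 2) by rewrite !pwD; ring.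
  apply: ler_pM; rewrite ?mulr_ge0 ?(ltW rho_gt0) ?(ltW (pw_gt0 _)) //.
    by rewrite /K2; lra.
  by apply: le_pw; lra.
- apply: le_trans hw; rewrite le_eqVlt; apply/orP; left; apply/eqP.
  apply: eq_bigr => i _; apply: eq_bigr => j _; congr (pr P _).
  by apply/funext => u; rewrite /mkset /receiver_obs [X in (X, _)]addrC.
- apply: le_trans hw'; rewrite le_eqVlt; apply/orP; left; apply/eqP.
  apply: eq_bigr => i _; apply: eq_bigr => j _; congr (pr P _).
  by apply/funext => u; rewrite /mkset /receiver_obs [X in (X, _)]addrC.
Qed.

End code_bounds.

(** * High SNR and the optimal rate split *)

Lemma powR_eventually_gt (R : realType) (K g : R) : 0 < g ->
  exists2 S0 : R, 1 <= S0 & forall S, S0 < S -> K < S `^ g.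
Proof.
move=> g0; have K1 : 1 <= `|K| + 1 by rewrite lerDr.
exists ((`|K| + 1) `^ g^-1).
  apply: (@le_trans _ _ (1 `^ g^-1)); first by rewrite powR1.
  apply: ge0_ler_powR => //; rewrite ?nnegrE // ?(le_trans _ K1) //.
  by rewrite invr_ge0 ltW.
move=> S hS; apply: (@lt_trans _ _ (`|K| + 1)).
  by rewrite (le_lt_trans (ler_norm K)) // ltrDl.
have -> : `|K| + 1 = ((`|K| + 1) `^ g^-1) `^ g.
  by rewrite -powRrM mulVf ?gt_eqF // powRr1 // (le_trans _ K1).
by rewrite gt0_ltr_powR // nnegrE ?powR_ge0 // ltW // (le_lt_trans _ hS) // powR_ge0.
Qed.

(** The target size is S^(N r) >= 1, so rounding leaves at least one message and loses at most a
    factor 2. *)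
Lemma size_ok_bound (R : realType) (N M : nat) (r S : R) : 1 < S -> 0 <= r ->
  size_ok N (r * log2 S) M -> (0 < M)%N /\ S `^ (N%:R * r) <= 2 * M%:R.
Proof.
move=> S1 r0; rewrite /size_ok.
have S0 : 0 < S by exact: lt_trans S1.
have l2 : 0 < ln 2 :> R by rewrite ln_gt0 // ltr1n.
have -> : 2 `^ (N%:R * (r * log2 S)) = S `^ (N%:R * r).
  rewrite /powR gt_eqF // gt_eqF //; congr expR; rewrite /log2; field.
  by rewrite gt_eqF.
have h1 : 1 <= S `^ (N%:R * r).
  by rewrite -[leLHS](powRr0 S) ler_powR // ?mulr_ge0 // ltW.
rewrite ltr_norml => /andP[ha hb].
have M0 : (0 < M)%N by rewrite -(ltr0n R); lra.
split=> //; have : 1 <= M%:R :> R by rewrite ler1n.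
by lra.
Qed.

Lemma size_ok_rate0 (R : realType) (N M : nat) (S : R) :
  size_ok N (0 * log2 S) M -> M = 1%N.
Proof.
rewrite /size_ok mul0r mulr0 powRr0 ltr_norml => /andP[h1 h2].
have M0 : (0 < M)%N by rewrite -(ltr0n R); lra.
have : (M < 2)%N by rewrite -(ltr_nat R); lra.
by case: M M0 {h1 h2} => [|[|]].
Qed.

Section asymptotics.
Context (R : realType) (d : measure_display) (T : measurableType d).
Variables (P : probability T R) (N : nat) (ch : channel R T N) (alpha r1 r2 : R).
Variable chi : R -> block_code R N.
Hypothesis hN : (0 < N)%N.
Hypothesis hch : rayleigh P ch.
Hypotheses (hr1 : 0 <= r1) (hr2 : 0 <= r2).
Hypothesis hchi : is_scheme r1 r2 chi.

Lemma perr_rate0 S : 1 < S -> r1 = 0 -> r2 = 0 -> perr P ch alpha chi S = 0.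
Proof.
move=> S1 r10 r20; have [[]] := hchi S1.
rewrite r10 r20 => /size_ok_rate0 h1 /size_ok_rate0 h2 _ _ _ _.
have ord1E M (i j : 'I_M) : M = 1%N -> i = j.
  by move=> M1; apply/val_inj; move: i j; rewrite M1 => i j; rewrite !ord1.
rewrite /perr /perr1 /perr2 !big1 ?mulr0 ?maxxx //.
  move=> m1 _; rewrite big1 // => m2 _; rewrite [X in P X](_ : _ = set0) ?measure0 //.
  by apply/seteqP; split => // w /=; apply; apply: ord1E.
move=> m1 _; rewrite big1 // => m2 _; rewrite [X in P X](_ : _ = set0) ?measure0 //.
by apply/seteqP; split => // w /=; apply; apply: ord1E.
Qed.

Variables e e' : R.
Hypotheses (e'_gt0 : 0 < e') (e'_lt1 : e' < 1) (e'_lt : e' < e).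
(** The negation of an eventual lower bound gives arbitrarily large [S] only, which is enough since
    each contradiction occurs at a single SNR. *)
Hypothesis small_error : forall S0 : R,
  exists2 S, S0 < S & perr P ch alpha chi S < S `^ (- e).

Let small_enough (K : R) : 0 < K -> exists2 S0 : R, 1 <= S0 &
  forall S, S0 < S -> 8 * S `^ (- e) <= K * S `^ (- e').
Proof.
move=> K0; have g0 : 0 < e - e' by rewrite subr_gt0.
have [S0 S01 h] := powR_eventually_gt (8 / K) g0; exists S0 => // S hS.
have S0' : 0 < S by rewrite (lt_trans _ hS) // (lt_le_trans _ S01).
have -> : - e' = - e + (e - e') by ring.
rewrite powRD; last by rewrite (gt_eqF S0') implybT.
rewrite mulrCA mulrC ler_pM2l ?powR_gt0 //.
by have := ltW (h _ hS); rewrite ler_pdivrMr // mulrC.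
Qed.

Let perr_max S : perr P ch alpha chi S < S `^ (- e) ->
  perr1 P ch S alpha (chi S) < S `^ (- e) /\ perr2 P ch S alpha (chi S) < S `^ (- e).
Proof. by rewrite /perr gt_max => /andP[]. Qed.

(** For large [S] the factor S^(N (x - y)) exceeds any constant [C], and S^(e - e') exceeds 8 /
    [K]. *)
Let absurd_rate (C K x y : R) : 0 < K -> 0 <= C -> y < x ->
  (forall S, 1 < S -> perr P ch alpha chi S < S `^ (- e) ->
     8 * S `^ (- e) <= K * S `^ (- e') ->
     S `^ (N%:R * x) <= C * S `^ (N%:R * y)) -> False.
Proof.
move=> K0 C0 yx H.
have g0 : 0 < N%:R * (x - y) :> R by rewrite mulr_gt0 ?ltr0n ?subr_gt0.
have [S1 S11 h1] := powR_eventually_gt C g0.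
have [S2 S21 h2] := small_enough K0.
have [S hS hp] := small_error (Num.max S1 S2).
move: hS; rewrite gt_max => /andP[hS1 hS2].
have S1' : 1 < S by rewrite (le_lt_trans _ hS1).
have S0 : 0 < S by exact: lt_trans S1'.
have := H S S1' hp (h2 _ hS2).
have -> : N%:R * x = N%:R * (x - y) + N%:R * y by ring.
rewrite powRD; last by rewrite (gt_eqF S0) implybT.
by rewrite ler_pM2r ?powR_gt0 // leNgt h1.
Qed.

Lemma converse_facts : [/\ r1 <= 1 - e', r2 <= 1 - e' &
  forall a b p q : R, 0 <= a -> 0 <= b -> 0 <= p -> 0 <= q -> a + b <= e' ->
    1 - b <= p -> alpha - a <= p -> 1 - e' - alpha + a <= q -> r1 + r2 <= p + q].
Proof.
have [c0 c00 hc0] := normal_prob_itv_ge R.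
(* [rho] is fixed before the SNR, so the constants below are uniform in [S]. *)
have [rho rho0 hrho] := noise_tight (P := P) (z := z1 ch)
  (let: And5 _ _ h _ _ := hch in h) (e := 8^-1) (ltac:(by rewrite invr_gt0)).
have u01 : 0 <= 1 - e' <= 1 by move: e'_gt0 e'_lt1 => ? ?; apply/andP; split; lra.
have k2 : 0 < 4 * c0 ^+ 2 by rewrite mulr_gt0 // exprn_gt0.
have k4 : 0 < 4 * c0 ^+ 4 by rewrite mulr_gt0 // exprn_gt0.
pose K1 : R := 4 * Num.sqrt N%:R + 2; pose K2 : R := 16 * rho + 2.
have K10 : 0 <= K1 by rewrite addr_ge0 // mulr_ge0 // sqrtr_ge0.
have K20 : 0 <= K2 by rewrite addr_ge0 // mulr_ge0 // ltW.
have C0 (K : R) : 0 <= K -> 0 <= (K * expR 2) ^+ (N * 2).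
  by move=> hK; rewrite exprn_ge0 // mulr_ge0 // expR_ge0.
split.
- rewrite leNgt; apply/negP => h.
  apply: (absurd_rate k2 (C := 2 * (2 * (K1 * expR 2) ^+ (N * 2))) _ h).
    by rewrite !mulr_ge0 // C0.
  move=> S S1 /perr_max[hp1 hp2] he.
  have [[z1s z2s] p1 p2 d1 d2] := hchi S1.
  have [M1 h1] := size_ok_bound S1 hr1 z1s; have [M2 h2] := size_ok_bound S1 hr2 z2s.
  apply: (le_trans h1); rewrite -mulrA ler_pM2l //.
  by apply: (code_bound1 hch c00 hc0 S1 d1 M1 M2 p1 hp1 u01); rewrite subKr.
- rewrite leNgt; apply/negP => h.
  apply: (absurd_rate k2 (C := 2 * (2 * (K1 * expR 2) ^+ (N * 2))) _ h).
    by rewrite !mulr_ge0 // C0.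
  move=> S S1 /perr_max[hp1 hp2] he.
  have [[z1s z2s] p1 p2 d1 d2] := hchi S1.
  have [M1 h1] := size_ok_bound S1 hr1 z1s; have [M2 h2] := size_ok_bound S1 hr2 z2s.
  apply: (le_trans h2); rewrite -mulrA ler_pM2l //.
  by apply: (code_bound2 hch c00 hc0 S1 d2 M1 M2 p2 hp2 u01); rewrite subKr.
move=> a b p q a0 b0 p0 q0 ab bp ap eq; rewrite leNgt; apply/negP => h.
pose K := Num.min (4 * c0 ^+ 2) (4 * c0 ^+ 4).
have K0 : 0 < K by rewrite lt_min k2.
apply: (absurd_rate K0
  (C := 4 * (4 * (K1 * expR 2) ^+ (N * 2) * (K2 * expR 2) ^+ (N * 2))) _ h).
  by rewrite !mulr_ge0 // C0.
move=> S S1 /perr_max[hp1 hp2] he.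
have S0 : 0 < S by exact: lt_trans S1.
have [[z1s z2s] p1 p2 d1 d2] := hchi S1.
have [M1 h1] := size_ok_bound S1 hr1 z1s; have [M2 h2] := size_ok_bound S1 hr2 z2s.
rewrite mulrDr powRD; last by rewrite (gt_eqF S0) implybT.
apply: (@le_trans _ _ (4 * (size1 (chi S) * size2 (chi S))%:R)).
  rewrite natrM; have -> : 4 * ((size1 (chi S))%:R * (size2 (chi S))%:R) =
    (2 * (size1 (chi S))%:R) * (2 * (size2 (chi S))%:R) :> R by ring.
  by apply: ler_pM; rewrite ?powR_ge0.
rewrite -[leRHS]mulrA ler_pM2l //.
apply: (code_bound12 hch c00 rho0 hc0 hrho S1 d1 d2 M1 M2 p1 p2 hp1 hp2 a0 b0
  (ltW e'_gt0) p0 q0 bp ap eq).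
- apply: (le_trans he); apply: ler_pM.
  + exact: ltW.
  + exact: powR_ge0.
  + by rewrite /K ge_min lexx orbT.
  + by rewrite ler_powR ?(ltW S1) // lerN2.
- by apply: (le_trans he); rewrite ler_pM2r ?powR_gt0 // /K ge_min lexx.
Qed.

End asymptotics.

Section optimal_split.
Context (R : realType).
Implicit Types a alpha s e : R.

Lemma pos_part_ge0 a : 0 <= pos_part a.
Proof. by rewrite /pos_part le_max lexx orbT. Qed.

Lemma pos_part_ge a : a <= pos_part a.
Proof. by rewrite /pos_part le_max lexx. Qed.

Lemma pos_part_id a : 0 <= a -> pos_part a = a.
Proof. by move=> a0; rewrite /pos_part max_l. Qed.

Lemma d1ETW_le1 alpha (r1 r2 s1 s2 : R) :
  d1ETW alpha r1 r2 s1 s2 <= d11 r1 /\ d1ETW alpha r1 r2 s1 s2 <= d12 r2.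
Proof. by rewrite /d1ETW !ge_min !lexx ?orbT. Qed.

Lemma d1ETW_ge0 alpha (r1 r2 s1 s2 : R) : 0 <= d1ETW alpha r1 r2 s1 s2.
Proof.
rewrite /d1ETW !le_min !pos_part_ge0 addr_ge0 ?pos_part_ge0 //= /d14.
by case: ifP => _ //; case: ifP => _ //; exact: pos_part_ge0.
Qed.

(** Only [d13] and [d14] depend on the split: [d14] is harmless at s = 0 and otherwise caps s at 1 -
    alpha - e, whereas [d13] grows with s. *)
Lemma optimal_split alpha (r1 r2 e : R) : 0 < e -> e < 1 -> 0 <= alpha ->
  0 <= r1 -> 0 <= r2 -> r1 <= 1 - e -> r2 <= 1 - e ->
  (forall a b p q : R, 0 <= a -> 0 <= b -> 0 <= p -> 0 <= q -> a + b <= e ->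
    1 - b <= p -> alpha - a <= p -> 1 - e - alpha + a <= q -> r1 + r2 <= p + q) ->
  exists2 s, 0 <= s <= r2 & e <= d1ETW alpha r1 r2 0 s.
Proof.
move=> e0 e1 al0 r10 r20 h1 h2 H.
have b1 : e <= d11 r1 by apply: le_trans (pos_part_ge _); lra.
have b2 : e <= d12 r2 by apply: le_trans (pos_part_ge _); lra.
have [ua|au] := leP (1 - e) alpha.
  exists 0; first by rewrite lexx r20.
  rewrite /d1ETW !le_min b1 b2 /= /d14 eqxx (ltW e1) andbT /d13 !addr0.
  rewrite leNgt; apply/negP.
  have x0 := pos_part_ge0 (1 - r1 - r2); have x1 := pos_part_ge (1 - r1 - r2).
  have y0 := pos_part_ge0 (alpha - r1 - r2); have y1 := pos_part_ge (alpha - r1 - r2).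
  move: (pos_part (1 - r1 - r2)) x0 x1 => x x0 x1.
  have [ra|ar] := leP (r1 + r2) alpha.
    rewrite pos_part_id; last by lra.
    move=> he.
    (* If [d13] were below [e], attenuations exceeding (alpha - r1 - r2)^+ and (1 - r1 - r2)^+ by
       [dlt] would still fit in the budget [e]. They push the power at receiver 1 down to r1 + r2 -
       [dlt] with q = 0, contradicting [H]. *)
    pose dlt :=
      Num.min ((e - (x + (alpha - r1 - r2))) / 2) (r1 + r2 - (1 - e)).
    have d0 : 0 < dlt by rewrite lt_min; apply/andP; split; lra.
    have d1 : dlt <= (e - (x + (alpha - r1 - r2))) / 2 by rewrite ge_min lexx.
    have d2 : dlt <= r1 + r2 - (1 - e) by rewrite ge_min lexx orbT.
    move: dlt d0 d1 d2 => dlt d0 d1 d2.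
    have : r1 + r2 <= r1 + r2 - dlt + 0.
      by apply: (H (alpha - r1 - r2 + dlt) (x + dlt)); lra.
    by lra.
  move: (pos_part (alpha - r1 - r2)) y0 y1 => y y0 y1 he.
  pose dlt := Num.min ((e - (x + y)) / 2)
    (Num.min (r1 + r2 - (1 - e)) (r1 + r2 - alpha)).
  have d0 : 0 < dlt by rewrite !lt_min; apply/andP; split; [|apply/andP; split]; lra.
  have d1 : dlt <= (e - (x + y)) / 2 by rewrite ge_min lexx.
  have d2 : dlt <= r1 + r2 - (1 - e) by rewrite !ge_min lexx orbT.
  have d3 : dlt <= r1 + r2 - alpha by rewrite !ge_min lexx !orbT.
  move: dlt d0 d1 d2 d3 => dlt d0 d1 d2 d3.
  have : r1 + r2 <= r1 + r2 - dlt + 0 by apply: (H 0 (x + dlt)); lra.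
  by lra.
(* With p = 1 - e and q = 1 - e - alpha this says that the first term of [d13] is at least [e] at s
   = 1 - e - alpha. *)
have sum_le : r1 + r2 <= (1 - e) + (1 - e - alpha) by apply: (H 0 e); lra.
have al1 : alpha < 1 by lra.
have [r2u|ur2] := leP r2 (1 - e - alpha).
  exists r2; first by rewrite r20 lexx.
  rewrite /d1ETW !le_min b1 b2 /= /d13 /d14 al1; apply/andP; split.
    have x1 := pos_part_ge (1 - r1 - r2 + r2).
    by have y0 := pos_part_ge0 (alpha - r1 - r2 + r2); lra.
  by case: ifP => _; [exact: ltW|apply: le_trans (pos_part_ge _); lra].
exists (1 - e - alpha); first by apply/andP; split; lra.
rewrite /d1ETW !le_min b1 b2 /= /d13 /d14 al1; apply/andP; split.
  have x1 := pos_part_ge (1 - r1 - r2 + (1 - e - alpha)).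
  by have y0 := pos_part_ge0 (alpha - r1 - r2 + (1 - e - alpha)); lra.
by case: ifP => _; [exact: ltW|apply: le_trans (pos_part_ge _); lra].
Qed.

Lemma d1ETW_values_split alpha (r1 r2 s : R) : 0 <= r1 -> 0 <= s <= r2 ->
  d1ETW_values alpha r1 r2 (d1ETW alpha r1 r2 0 s).
Proof.
move=> r10 /andP[s0 sr]; exists 0, s, r1, (r2 - s); split => //.
  by split; rewrite ?add0r ?lexx ?r10.
by split; [rewrite addrC subrK|rewrite s0|rewrite subr_ge0 sr lerBlDr lerDl].
Qed.

(* The case s2 = 0 of d14 breaks continuity, but only by raising the value there. *)
Lemma exists_max_d1ETW alpha (r1 r2 : R) : 0 <= alpha -> 0 <= r1 -> 0 <= r2 ->
  exists D, is_max (d1ETW_values alpha r1 r2) D.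
Proof.
move=> al0 r10 r20.
(* [f] continues the branch s2 > 0 of [d14] down to 0; the factor [k] covers alpha >= 1. The maximum
   is then that of [f] or the separate value at 0. *)
pose k := if alpha < 1 then 1 else 0 : R.
pose f s := Num.min (Num.min (d11 r1) (d12 r2))
   (Num.min (d13 alpha r1 r2 s) (k * pos_part (1 - alpha - s))).
have cpp (g : R -> R) : continuous g -> continuous (fun s => pos_part (g s)).
  move=> cg s; apply: (@continuous_max _ _ g (fun=> 0) s); [exact: cg|exact: cvg_cst].
have cf : continuous f.
  have caff (u : R) : continuous (fun s : R => u + s).
    by move=> s; apply: cvgD; [exact: cvg_cst|exact: cvg_id].
  have caffN (u : R) : continuous (fun s : R => u - s).
    by move=> s; apply: cvgB; [exact: cvg_cst|exact: cvg_id].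
  move=> s.
  apply: (@continuous_min _ _ (fun=> _)
    (fun s => Num.min (d13 alpha r1 r2 s) (k * pos_part (1 - alpha - s))) s).
    exact: cvg_cst.
  apply: (@continuous_min _ _ (d13 alpha r1 r2)
    (fun s => k * pos_part (1 - alpha - s)) s).
    apply: cvgD; first exact: (cpp (fun s => 1 - r1 - r2 + s) (caff _) s).
    exact: (cpp (fun s => alpha - r1 - r2 + s) (caff _) s).
  apply: cvgM; first exact: cvg_cst.
  exact: (cpp (fun s => 1 - alpha - s) (caffN _) s).
have [c + cmax] := EVT_max r20 (continuous_subspaceT cf).
rewrite in_itv /= => c0r2.
have fd s s1 : s != 0 -> d1ETW alpha r1 r2 s1 s = f s.
  move=> s0; rewrite /d1ETW /f /d14 (negPf s0) /k.
  by case: ifP; rewrite ?mul1r ?mul0r.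
have fd0 s1 : f 0 <= d1ETW alpha r1 r2 s1 0.
  have k1 : k * pos_part (1 - alpha - 0) <= d14 alpha 0.
    rewrite /d14 eqxx /k; case: ifP => _; rewrite ?mul0r // mul1r subr0.
    by rewrite /pos_part ge_max ler01 andbT; lra.
  by rewrite /f /d1ETW !le_min !ge_min !lexx k1 !orbT.
have dle s1 s : 0 <= s <= r2 ->
    d1ETW alpha r1 r2 s1 s <= Num.max (d1ETW alpha r1 r2 0 0) (f c).
  move=> hs; have [->|s0] := eqVneq s 0; first by rewrite le_max lexx.
  by rewrite fd // le_max cmax ?orbT // in_itv.
exists (Num.max (d1ETW alpha r1 r2 0 0) (f c)); split; last first.
  by move=> _ [s1 [s2 [t1 [t2 [_ [_ hs _] ->]]]]]; exact: dle.
have [cle|clt] := leP (f c) (d1ETW alpha r1 r2 0 0).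
  by apply: d1ETW_values_split => //; rewrite lexx.
have c0 : c != 0 by apply: contraTneq clt => ->; rewrite -leNgt fd0.
by rewrite -(fd c 0 c0); exact: d1ETW_values_split.
Qed.

End optimal_split.

(** * Exponents, limits and the outer bound *)

Section exponents.
Context (R : realType).
Implicit Types (f : R -> R) (S e D : R).

Lemma exponentE f S : exponent f S = (ln (f S) / ln S)%:E.
Proof.
have l2 : ln 2 != 0 :> R by rewrite gt_eqF // ln_gt0 // ltr1n.
by rewrite /exponent /log2 invfM invrK mulrACA mulVf // mulr1.
Qed.

Lemma exponent_powR e S : 1 < S -> exponent (fun x => x `^ e) S = e%:E.
Proof.
move=> S1; rewrite exponentE ln_powR mulfK // gt_eqF // ln_gt0 //.
Qed.

Lemma exponent_ge f e S : 1 < S -> S `^ e <= f S -> (e%:E <= exponent f S)%E.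
Proof.
move=> S1 h; have S0 : 0 < S by exact: lt_trans S1.
rewrite exponentE lee_fin ler_pdivlMr ?ln_gt0 // -ln_powR ler_ln //.
  by rewrite posrE powR_gt0.
by rewrite posrE (lt_le_trans _ h) // powR_gt0.
Qed.

(** For S > 1 the logarithm is positive, so bounds on [f] pass to exponents: the power has exponent
    exactly -D, and the lower limit for [f] is at least -(D + e) for every e > 0. *)
Lemma dot_ge_powR f D :
  (forall e, D < e -> \forall S \near +oo, S `^ (- e) <= f S) ->
  dot_ge f (fun S => S `^ (- D)).
Proof.
move=> H; apply: (@le_trans _ _ (- D)%:E).
  rewrite limf_esupE.
  apply: (@le_trans _ _ (ereal_sup (exponent (fun S => S `^ - D) @` [set S | 1 < S]))).
    apply: ereal_inf_lbound; exists [set S | 1 < S] => //.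
    by exists 1; split => //; exact: num_real.
  by apply: ge_ereal_sup => _ [S /= S1 <-]; rewrite exponent_powR.
rewrite limf_einfE; apply/lee_addgt0Pr => e e0; rewrite -leeBlDr // -EFinB.
have De : D < D + e by rewrite ltrDl.
have [A [Areal hA]] := H _ De.
apply: (@le_trans _ _ (ereal_inf (exponent f @` [set S | Num.max 1 A < S]))).
  apply: le_ereal_inf_tmp => _ [S /= + <-]; rewrite gt_max => /andP[S1 AS].
  by apply: exponent_ge => //; rewrite -opprD; exact: hA.
apply: ereal_sup_ubound; exists [set S | Num.max 1 A < S] => //.
by exists (Num.max 1 A); split => //; exact: num_real.
Qed.

Lemma diversity_le f D (dchi : \bar R) :
  (forall e, D < e -> \forall S \near +oo, S `^ (- e) <= f S) ->
  has_diversity f dchi -> (dchi <= D%:E)%E.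
Proof.
move=> H hd; apply/lee_addgt0Pr => e e0; rewrite -EFinD.
have De : D < D + e by rewrite ltrDl.
apply: cvge_le hd; near=> S.
rewrite leeNl -EFinN; apply: exponent_ge; near: S => //.
  by exists 1; split => //; exact: num_real.
exact: H.
Unshelve. all: by end_near. Qed.

End exponents.

Theorem mainTheorem3 (R : realType) (d : measure_display) (T : measurableType d)
    (P : probability T R) (N : nat) (ch : channel R T N) (alpha r1 r2 : R)
    (chi : R -> block_code R N)
    (hN : (0 < N)%N)
    (hch : rayleigh P ch)
    (halpha : 0 <= alpha)
    (hr1 : 0 <= r1 <= 1)
    (hr2 : 0 <= r2 <= 1)
    (hchi : is_scheme r1 r2 chi)
    (hpos : \forall snr \near +oo, 0 < perr P ch alpha chi snr) :
  exists D : R,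
    [/\ is_max (d1ETW_values alpha r1 r2) D,
        dot_ge (perr P ch alpha chi) (fun snr => snr `^ (- D))
      & forall dchi : \bar R,
          has_diversity (perr P ch alpha chi) dchi -> (dchi <= D%:E)%E].
Proof.
have [/andP[r10 _] /andP[r20 _]] := (hr1, hr2).
have [D hD] := exists_max_d1ETW halpha r10 r20.
suff key e : D < e -> \forall S \near +oo, S `^ (- e) <= perr P ch alpha chi S.
  exists D; split => //; first exact: dot_ge_powR.
  by move=> dchi; exact: diversity_le.
move=> De; apply: contrapT => nH.
have small S0 : exists2 S, S0 < S & perr P ch alpha chi S < S `^ (- e).
  apply: contrapT => h; apply: nH; exists S0; split; first exact: num_real.
  by move=> S hS; rewrite leNgt; apply/negP => hp; apply: h; exists S.
have [[s1 [s2 [t1 [t2 [_ _ DE]]]]] Dmax] := hD.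
have D0 : 0 <= D by rewrite DE d1ETW_ge0.
have [D1|D1] := ltP D 1.
  (* A midpoint, so that D < e' < e and e' < 1 hold together. *)
  pose e' := (D + Num.min e 1) / 2.
  have m1 : Num.min e 1 <= e by rewrite ge_min lexx.
  have m2 : Num.min e 1 <= 1 by rewrite ge_min lexx orbT.
  have m3 : D < Num.min e 1 by rewrite lt_min De.
  have De' : D < e' by rewrite /e'; lra.
  have e'0 : 0 < e' by lra.
  have e'1 : e' < 1 by rewrite /e'; lra.
  have e'e : e' < e by rewrite /e'; lra.
  have [h1 h2 h3] := converse_facts hN hch r10 r20 hchi e'0 e'1 e'e small.
  have [s hs] := optimal_split e'0 e'1 halpha r10 r20 h1 h2 h3.
  (* The split attains at least e' > D, against the maximality of [D]. *)
  apply/negP; rewrite -ltNge (le_lt_trans _ De') // Dmax //.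
  exact: d1ETW_values_split.
(* Now D >= 1, so both single-user terms are at least 1 and both rates are 0. *)
have [d1 d2] := d1ETW_le1 alpha r1 r2 s1 s2.
have rate0 r : 0 <= r -> 1 <= pos_part (1 - r) -> r = 0.
  by move=> r0; rewrite /pos_part le_max => /orP[|]; lra.
have r1E : r1 = 0 by apply: rate0 => //; rewrite (le_trans D1) // DE.
have r2E : r2 = 0 by apply: rate0 => //; rewrite (le_trans D1) // DE.
have [A [_ hA]] := hpos.
have : 0 < perr P ch alpha chi (Num.max 1 A + 1).
  by apply: hA; rewrite ltr_pwDr // le_max lexx orbT.
by rewrite (perr_rate0 P ch alpha hchi) ?ltxx // ltr_pwDr // le_max lexx.
Qed.
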